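(* Let $c>0$. The function $$\Phi_Y(z)=W_0\left(-ce^{-c-z}\right)-W_0\left(-ce^{-c}\right),\qquad z\ge0,$$ is the Laplace exponent of a compound Poisson process $Y$. For $t>0$ the distribution of $Y_t$ is supported on $\{0,1,2,\dots\}$ and is given by $$\mathbb P(Y_t=n)=ct\,\frac{(c(n+t))^{n-1}}{n!}\,e^{-c(n+t)+at},\qquad n\ge0,$$ where $a:=0$ if $c\le1$ and $a:=c+W_0(-ce^{-c})$ if $c>1$. The Lévy measure of $Y$ is given by $$\Pi_Y(\{n\})=\frac{n^{n-1}}{n!}\,c^n e^{-cn},\qquad n\ge1.$$
   Context: $W_0$ is the principal real branch of the Lambert W-function: for $x\ge-1/e$, $W_0(x)$ is the unique real solution $w\ge-1$ of $we^w=x$; it is increasing and maps $[-1/e,\infty)$ onto $[-1,\infty)$. The Laplace exponent of a subordinator $Y$ is $\Phi_Y(z)=-\ln\mathbb E[e^{-zY_1}]$, $z\ge0$, and the Lévy measure $\Pi_Y$ of a subordinator with zero drift and zero killing rate is given by $\Phi_Y(z)=\int_{(0,\infty)}(1-e^{-zx})\,\Pi_Y(dx)$. *)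

(* Defs.v *)
From HB Require Import structures.
From mathcomp Require Import all_boot all_order all_algebra.
From mathcomp Require Import all_classical all_reals all_analysis.

Set Implicit Arguments.
Unset Strict Implicit.
Unset Printing Implicit Defensive.

Import Order.TTheory GRing.Theory Num.Theory.
Import numFieldNormedType.Exports.

Local Open Scope classical_set_scope.
Local Open Scope ring_scope.

(* Principal branch of the Lambert function; only meaningful for x >= -1/e,
   where the set below is a singleton (outside, the value is the dummy 0). *)
Definition lambertW0 {R : realType} (x : R) : R :=
  xget 0 [set w | -1 <= w /\ w * expR w = x].

(* Joint independence of an arbitrary family: the product rule holds over every
   finite subfamily, listed without repetition by s. *)
Definition mutually_independent {d : measure_display} {T : measurableType d}
    {R : realType} (P : probability T R) {I : eqType}
    (X : I -> {RV P >-> R}) : Prop :=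
  forall (s : seq I) (A : I -> set R), uniq s ->
    (forall i, measurable (A i)) ->
    P (\big[setI/setT]_(i <- s) (X i @^-1` A i)) =
    (\prod_(i <- s) P (X i @^-1` A i))%E.

(* Compound Poisson process with positive jumps, i.e. a compound Poisson
   process that is a subordinator: Y_t = \sum_(i < N_t) xi_i, where N is the
   Poisson process of rate lambda with i.i.d. exponential interarrival times
   tau_0, tau_1, ..., so that N_t = n iff
     tau_0 + ... + tau_(n-1) <= t < tau_0 + ... + tau_n,
   and the jumps xi_i are i.i.d., positive, and independent of the tau_i.
   Only the variables Y t with 0 <= t are constrained. *)
Definition compound_poisson {d : measure_display} {T : measurableType d}
    {R : realType} (P : probability T R) (Y : R -> {RV P >-> R}) : Prop :=
  exists (lambda : R) (tau xi : nat -> {RV P >-> R}) (N : R -> T -> nat),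
  [/\ 0 < lambda,
      mutually_independent
        (fun k : nat + nat => match k with inl i => tau i | inr i => xi i end),
      (forall (i : nat) (A : set R), measurable A ->
         distribution P (tau i) A = exponential_prob lambda A),
      (forall (i : nat) (A : set R), measurable A ->
         distribution P (xi i) A = distribution P (xi 0%N) A) /\
      (forall i : nat, P [set w | 0 < xi i w] = 1%E)
    & {ae P, forall w, forall t : R, 0 <= t ->
         [/\ \sum_(i < N t w) tau i w <= t,
             t < \sum_(i < (N t w).+1) tau i w
           & Y t w = \sum_(i < N t w) xi i w]}].

Definition laplace_exponent {d : measure_display} {T : measurableType d}
    {R : realType} (P : probability T R) (Y : R -> {RV P >-> R}) (z : R) : R :=
  - ln (fine 'E_P[fun w => expR (- z * Y 1 w)]).

(* Pi is a Levy measure of the subordinator Y (zero drift, zero killing rate);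
   Pi lives on ]0, +oo[, seen as a Borel measure on R not charging ]-oo, 0]. *)
Definition is_levy_measure {d : measure_display} {T : measurableType d}
    {R : realType} (P : probability T R) (Y : R -> {RV P >-> R})
    (Pi : {measure set R -> \bar R}) : Prop :=
  Pi `]-oo, 0]%classic = 0%E /\
  forall z : R, 0 <= z ->
    (laplace_exponent Y z)%:E =
    (\int[Pi]_(x in `]0%R, +oo[) (1 - expR (- z * x))%:E)%E.

(* Main.v *)
Require Import Defs.
From HB Require Import structures.
From mathcomp Require Import all_boot all_order all_algebra.
From mathcomp Require Import all_classical all_reals all_analysis.
From mathcomp Require Import measurable_realfun.
From mathcomp Require Import zify ring lra.

Set Implicit Arguments.
Unset Strict Implicit.
Unset Printing Implicit Defensive.

Import Order.TTheory GRing.Theory Num.Theory.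
Import numFieldNormedType.Exports.

Local Open Scope classical_set_scope.
Local Open Scope ring_scope.

(** The exponent is governed by the tree function T, the inverse of u exp (- u) on
    [0, 1]. Put u(z) := - W0 (- c exp (- c - z)), so that u(z) lies in ]0, 1] and
    u(z) exp (- u(z)) = x with x = c exp (- c) exp (- z); then
    Phi_Y(z) = u(0) - u(z), and the expansions

      u = T(x) = sum of n ^ (n - 1) / n! x ^ n,
      exp (t u) = sum of t (t + n) ^ (n - 1) / n! x ^ n

    are power series in exp (- z) with nonnegative coefficients. The first one is
    the Laplace transform of the announced Levy measure, and the second one,
    multiplied by exp (- t u(0)), is that of the announced law of Y_t.

    The expansions come from Abel's binomial identity [abel_identity], which is the
    vanishing of high finite differences of a power. It says that the series of the
    second kind are multipliers of the series of (y + n) ^ n / n! x ^ n, and forces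
    them to be exponentials [tree_series_fixpoint]. That the solution found is the
    one below 1 follows by monotonicity [tree_series_le1], and the value at the
    radius of convergence, reached when c = 1 and z = 0, follows by continuity
    [tree_series_expRN1].

    For a compound Poisson process of rate lambda whose jumps have transform phi,
    the transform of Y_t is exp (- t lambda (1 - phi(z)))
    [compound_poisson_transform]. The number of arrivals is Poisson: integrating the
    exponential clocks out one at a time preserves a family of weights
    [integral_arrival_weight]. Disjoint groups of clocks and jumps are independent by
    a pi-lambda argument [family_sigma_independent]. Consequently the transform of
    Y_t is exp (- t Phi_Y(z)) whenever Phi_Y is the exponent, and lambda times the
    law of a jump is a Levy measure.

    The laws are then recovered from their transforms. A measure whose transform is
    a power series in exp (- z) with nonnegative coefficients charges only the
    natural numbers, with masses given by the coefficients, because the behaviour at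
    infinity reveals the atoms one after another [laplace_series_unique]. For the
    Levy measure, the total mass has first to be read off the limit of the exponent
    [levy_measure_atoms].

    For existence, the jumps are given the Levy weights divided by their sum u(0),
    and the rate is u(0). A countable independent family with given laws is built on
    the line: the binary digits of a uniform point are independent, since the
    doubling map preserves the uniform law [half_bit_split]; disjoint sequences of
    digits make independent uniform variables [binary_tail], and quantile functions
    change them into variables with the given laws [exists_independent_family]. *)

(** * Abel's binomial identity *)

(** A finite difference of order n kills powers of degree less than n. By
    induction on the degree: one factor x + i is split into x, which leaves a
    smaller power, and i, which i * 'C(n.+1, i) = n.+1 * 'C(n, i.-1) turns into a
    difference of order n, taken from x + 1. *)
Lemma alternating_binomial_sum (K : comNzRingType) (n m : nat) (x : K) :
  (m < n)%N ->
  \sum_(i < n.+1) (-1) ^+ i * (x + i%:R) ^+ m *+ 'C(n, i) = 0.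
Proof.
elim: m n x => [|m IH] n x mn.
  transitivity ((1 - 1 : K) ^+ n); last by rewrite subrr expr0n eqn0Ngt mn/=.
  by rewrite exprBn; apply: eq_bigr => i _; rewrite expr0 !expr1n !mulr1.
case: n mn => // n mn.
have split_factor : \sum_(i < n.+2) (-1) ^+ i * (x + i%:R) ^+ m.+1 *+ 'C(n.+1, i) =
    x * (\sum_(i < n.+2) (-1) ^+ i * (x + i%:R) ^+ m *+ 'C(n.+1, i)) +
    \sum_(i < n.+2) (-1) ^+ i * (x + i%:R) ^+ m *+ (i * 'C(n.+1, i))%N.
  rewrite mulr_sumr -big_split/=; apply: eq_bigr => i _.
  rewrite exprS mulnC mulrnA; ring.
rewrite split_factor IH 1?ltnW// mulr0 add0r big_ord_recl/= mul0n mulr0n add0r.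
rewrite (eq_bigr (fun i : 'I_n.+1 => - n.+1%:R *
    ((-1) ^+ i * ((x + 1) + i%:R) ^+ m *+ 'C(n, i)))); last first.
  move=> i _; rewrite /bump/= add1n -mul_bin_diag mulrnA exprS.
  have -> : x + i.+1%:R = x + 1 + i%:R by ring.
  ring.
by rewrite -mulr_sumr IH ?mulr0.
Qed.

(** The coefficient of x ^ n / n! in exp (t T(x)), where T is the tree function.
    At n = 0 the closed form t (t + n) ^ (n - 1) would have a negative
    exponent. *)
Definition abel_coeff (K : nzRingType) (t : K) (n : nat) : K :=
  if n is m.+1 then t * (t + n%:R) ^+ m else 1.

(** Expand y + (n - i) as w - (s + i) in powers of w := s + y + n. The coefficient
    of w ^ j is, up to a factor free of i, s times the difference of order n - j
    of the powers (s + i) ^ (n - j - 1): it vanishes unless j = n. *)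
Lemma abel_identity (K : fieldType) (n : nat) (s y : K) :
  \sum_(i < n.+1) abel_coeff s i * (y + (n - i)%:R) ^+ (n - i) *+ 'C(n, i) =
  (s + y + n%:R) ^+ n.
Proof.
set w := s + y + n%:R.
pose term (i j : nat) : K := w ^+ j * (abel_coeff s i *
   (- (s + i%:R)) ^+ (n - j - i)) *+ ('C(n, j) * 'C(n - j, i))%N.
have expand (i : 'I_n.+1) :
    abel_coeff s i * (y + (n - i)%:R) ^+ (n - i) *+ 'C(n, i) =
    \sum_(j < n.+1) term i j.
  have le_in : (i <= n)%N by rewrite -ltnS.
  have -> : y + (n - i)%:R = - (s + i%:R) + w by rewrite natrB// /w; ring.
  rewrite exprDn mulr_sumr -sumrMnl.
  rewrite (big_ord_widen n.+1 (fun j => abel_coeff s i *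
     ((- (s + i%:R)) ^+ (n - i - j) * w ^+ j *+ 'C(n - i, j)) *+ 'C(n, i)));
    last by rewrite ltnS leq_subr.
  rewrite big_mkcond/=; apply: eq_bigr => j _; rewrite /term.
  have le_jn : (j <= n)%N by rewrite -ltnS.
  case: ifPn => [ji|]; last first.
    rewrite -leqNgt => ij; rewrite [X in (_ * X)%N]bin_small ?muln0//.
    by rewrite ltn_subLR// addnC -ltn_subLR.
  have -> : ('C(n, j) * 'C(n - j, i) = 'C(n, i) * 'C(n - i, j))%N.
    have le_ijn : (i + j <= n)%N by lia.
    apply/eqP; rewrite -(eqn_pmul2r (fact_gt0 i)) -(eqn_pmul2r (fact_gt0 j)).
    rewrite -(eqn_pmul2r (fact_gt0 (n - i - j))); apply/eqP.
    have b1 := bin_fact le_in; have b2 := bin_fact le_jn.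
    have le1 : (j <= n - i)%N by lia.
    have le2 : (i <= n - j)%N by lia.
    have b3 := bin_fact le1; have b4 := bin_fact le2.
    rewrite subnAC in b4.
    transitivity n`!%N.
      by rewrite -b2 -b4; ring.
    by rewrite -b1 -b3; ring.
  rewrite subnAC !mulrnA; ring.
rewrite (eq_bigr _ (fun i _ => expand i)) exchange_big/= big_ord_recr/=.
rewrite [X in X + _]big1 ?add0r => [|j _].
  rewrite (bigD1 ord0)//= big1 ?addr0 => [|i i0].
    by rewrite /term subnn/= mulr1 mulr1 binn bin0 mulr1n.
  by rewrite /term subnn bin0n (negbTE (i0 : (i : nat) != 0%N)) muln0.
have jn : (0 < n - j)%N by rewrite subn_gt0.
pose k := (n - j).-1.
have nj : (n - j = k.+1)%N by rewrite prednK.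
have -> : \sum_(i < n.+1) term i j = \sum_(i < k.+2) term i j.
  rewrite [RHS](big_ord_widen n.+1 (fun i => term i j)); last first.
    by rewrite -nj ltnS leq_subr.
  rewrite [RHS]big_mkcond/= -nj; apply: eq_bigr => i _; case: ifPn => //.
  by rewrite -leqNgt => ji; rewrite /term [X in (_ * X)%N]bin_small ?muln0.
transitivity ((-1) ^+ k.+1 * w ^+ j * s *+ 'C(n, j) *
   \sum_(i < k.+2) (-1) ^+ i * (s + i%:R) ^+ k *+ 'C(k.+1, i)); last first.
  by rewrite alternating_binomial_sum// mulr0.
rewrite mulr_sumr; apply: eq_bigr => i _; rewrite /term nj.
have le_ik : (i <= k.+1)%N by rewrite -ltnS.
have -> : abel_coeff s i * (- (s + i%:R)) ^+ (k.+1 - i) =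
    (-1) ^+ k.+1 * (-1) ^+ i * (s * (s + i%:R) ^+ k).
  have sign : (-1) ^+ k.+1 * (-1) ^+ i = (-1) ^+ (k.+1 - i) :> K.
    have -> : (-1) ^+ k.+1 = (-1) ^+ (k.+1 - i) * (-1) ^+ i :> K.
      by rewrite -exprD subnK.
    by rewrite -mulrA -exprD addnn -mul2n exprM sqrrN !expr1n mulr1.
  rewrite (exprNn (s + i%:R)) -sign mulrCA; congr (_ * _).
  (* For i = 0 the coefficient is 1 and no power of s has been split off. *)
  case: i {sign} le_ik => -[|i]/= i2 le_ik.
    by rewrite mul1r addr0 subn0 exprS.
  by rewrite -mulrA -exprD subSS subnKC.
rewrite mulrnA; ring.
Qed.

(** * The tree function *)

Section nonnegative_series.
Local Open Scope ereal_scope.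

(** Row i is moved to the right by i places, and the two sums are exchanged. *)
Lemma nneseries_triangle (R : realType) (f : nat -> nat -> \bar R) :
  (forall i j, 0 <= f i j) ->
  \sum_(i <oo) \sum_(j <oo) f i j =
  \sum_(n <oo) \sum_(i < n.+1) f i (n - i)%N.
Proof.
move=> f0.
pose g i n := if (i <= n)%N then f i (n - i)%N else 0.
have g0 i n : 0 <= g i n by rewrite /g; case: ifP.
have shift i : \sum_(j <oo) f i j = \sum_(n <oo) g i n.
  rewrite (eq_eseriesr (g := fun j => f i ((j + i) - i)%N)); last first.
    by move=> j _; rewrite addnK.
  rewrite (nneseries_addn (f := fun n => f i (n - i)%N))//.
  by rewrite ereal_series eseries_mkcond.
rewrite (eq_eseriesr (fun i _ => shift i)) nneseries_interchange//.
apply: eq_eseriesr => n _.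
rewrite (nneseries_split 0%N n.+1)// add0n eseries0 ?adde0 => [|i ni _].
  rewrite big_mkord; apply: eq_bigr => i _.
  by rewrite /g -ltnS ltn_ord.
by rewrite /g leqNgt ni.
Qed.

Lemma nneseries_cauchy_product (R : realType) (a b : nat -> R) :
  (forall i, (0 <= a i)%R) -> (forall i, (0 <= b i)%R) ->
  \sum_(j <oo) (b j)%:E < +oo ->
  (\sum_(i <oo) (a i)%:E) * (\sum_(j <oo) (b j)%:E) =
  \sum_(n <oo) (\sum_(i < n.+1) a i * b (n - i)%N)%:E.
Proof.
move=> a0 b0 boo.
have b0' : 0 <= \sum_(j <oo) (b j)%:E.
  by apply: nneseries_ge0 => j _ _; rewrite lee_fin.
have bfin := ge0_fin_numE b0'; rewrite boo in bfin.
rewrite muleC -(fineK bfin) -nneseriesZl; last by move=> i _; rewrite lee_fin.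
rewrite (eq_eseriesr (g := fun i => \sum_(j <oo) (a i * b j)%:E)); last first.
  by move=> i _; rewrite (fineK bfin) muleC -nneseriesZl// => j _; exact/b0.
rewrite nneseries_triangle => [|i j]; last by rewrite lee_fin mulr_ge0.
by apply: eq_eseriesr => n _; rewrite sumEFin.
Qed.
End nonnegative_series.

Section tree_function.
Context {R : realType}.
Implicit Types (s t x y u : R).

(** The expansion of exp (t T(x)). *)
Definition abel_series t x : \bar R :=
  (\sum_(n <oo) (abel_coeff t n / n`!%:R * x ^+ n)%:E)%E.

(** The expansion of exp (y T(x)) / (1 - T(x)). *)
Definition abel_power_series y x : \bar R :=
  (\sum_(n <oo) ((y + n%:R) ^+ n / n`!%:R * x ^+ n)%:E)%E.

Lemma abel_coeff_ge0 t n : 0 <= t -> 0 <= abel_coeff t n.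
Proof.
by case: n => //= n t0; rewrite mulr_ge0// exprn_ge0// addr_ge0.
Qed.

Lemma fact_neq0 n : (n`!%:R : R) != 0.
Proof. by rewrite pnatr_eq0 -lt0n fact_gt0. Qed.

Lemma exprn_fact_le_expR n x : 0 <= x -> x ^+ n / n`!%:R <= expR x.
Proof.
case: n => [|n] x0; first by rewrite expr0 fact0 divr1 -[leLHS]expR0 ler_expR.
by apply: le_trans (expR_ge1Dxn n x0); rewrite lerDr.
Qed.

Lemma nneseries_expR x : 0 <= x ->
  (\sum_(n <oo) (x ^+ n / n`!%:R)%:E = (expR x)%:E)%E.
Proof.
move=> x0.
rewrite /expR -EFin_lim; last exact: is_cvg_series_exp_coeff.
by apply: congr_lim; apply/funext => n; rewrite /= sumEFin.
Qed.

Lemma nneseries_geometric x : 0 <= x -> x < 1 ->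
  (\sum_(n <oo) (x ^+ n)%:E = (1 - x)^-1%:E)%E.
Proof.
move=> x0 x1.
have xn1 : `|x| < 1 by rewrite ger0_norm.
have /(cvg_lim (@Rhausdorff R)) := @cvg_geometric_series R 1 x xn1.
rewrite div1r => <-; rewrite -EFin_lim; last exact: is_cvg_geometric_series.
apply: congr_lim; apply/funext => n /=; rewrite sumEFin; congr EFin.
by apply: eq_bigr => i _; rewrite /= mul1r.
Qed.

Lemma abel_power_series_ge1 y x : 0 <= y -> 0 <= x ->
  (1 <= abel_power_series y x)%E.
Proof.
move=> y0 x0.
rewrite /abel_power_series (nneseries_split 0%N 1%N) => [|k _]; last first.
  by rewrite lee_fin mulr_ge0 ?exprn_ge0// divr_ge0 ?exprn_ge0 ?addr_ge0.
rewrite add0n big_nat1 expr0 expr0 fact0 divr1 mulr1 leeDl//.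
apply: nneseries_ge0 => n _ _.
by rewrite lee_fin mulr_ge0 ?exprn_ge0// divr_ge0 ?exprn_ge0 ?addr_ge0.
Qed.

(** Since (y + n) ^ n / n! <= exp (y + n), the series is dominated by a geometric
    series of ratio e x. *)
Lemma abel_power_series_lty y x : 0 <= y -> 0 <= x -> expR 1 * x < 1 ->
  (abel_power_series y x < +oo)%E.
Proof.
move=> y0 x0 ex1.
apply: (@le_lt_trans _ _
    (\sum_(n <oo) (expR y)%:E * ((expR 1 * x) ^+ n)%:E)%E); last first.
  rewrite nneseriesZl; last first.
    by move=> n _; rewrite lee_fin exprn_ge0// mulr_ge0 ?expR_ge0.
  by rewrite nneseries_geometric ?ltry ?mulr_ge0 ?expR_ge0.
apply: lee_nneseries => n _.
  by rewrite lee_fin mulr_ge0 ?exprn_ge0// divr_ge0 ?exprn_ge0 ?addr_ge0.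
rewrite lee_fin exprMn mulrA ler_wpM2r ?exprn_ge0//.
by rewrite -expRM_natr mul1r -expRD exprn_fact_le_expR ?addr_ge0.
Qed.

(** Abel's identity, read on the coefficients of a Cauchy product. *)
Lemma abel_seriesM s y x : 0 <= s -> 0 <= y -> 0 <= x -> expR 1 * x < 1 ->
  (abel_series s x * abel_power_series y x = abel_power_series (s + y) x)%E.
Proof.
move=> s0 y0 x0 ex1; rewrite nneseries_cauchy_product; last 3 first.
- by move=> i; rewrite mulr_ge0 ?exprn_ge0// divr_ge0 ?abel_coeff_ge0.
- by move=> i; rewrite mulr_ge0 ?exprn_ge0// divr_ge0 ?exprn_ge0 ?addr_ge0.
- exact: abel_power_series_lty.
apply: eq_eseriesr => n _; congr EFin.
rewrite -abel_identity !mulr_suml; apply: eq_bigr => i _.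
have le_in : (i <= n)%N by rewrite -ltnS.
have -> : x ^+ n = x ^+ i * x ^+ (n - i) by rewrite -exprD subnKC.
have -> : n`!%:R = 'C(n, i)%:R * i`!%:R * (n - i)`!%:R :> R.
  by rewrite -!natrM -mulnA bin_fact.
rewrite -mulr_natr; field.
by rewrite !fact_neq0 pnatr_eq0 -lt0n bin_gt0 le_in.
Qed.

(** The binomial expansion of (t + n) ^ n in powers of t, summed by antidiagonals. *)
Lemma abel_power_series_shift t x : 0 <= t -> 0 <= x ->
  (abel_power_series t x =
   \sum_(j <oo) ((t * x) ^+ j / j`!%:R)%:E * abel_power_series j%:R x)%E.
Proof.
move=> t0 x0.
transitivity (\sum_(j <oo) \sum_(m <oo)
    ((t * x) ^+ j / j`!%:R * ((j%:R + m%:R) ^+ m / m`!%:R * x ^+ m))%:E)%E.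
  rewrite nneseries_triangle => [|j m]; last first.
    rewrite lee_fin !(mulr_ge0, divr_ge0, exprn_ge0)//.
  apply: eq_eseriesr => n _; rewrite sumEFin; congr EFin.
  rewrite [t + _]addrC exprDn !mulr_suml; apply: eq_bigr => j _.
  have le_jn : (j <= n)%N by rewrite -ltnS.
  have -> : x ^+ n = x ^+ j * x ^+ (n - j) by rewrite -exprD subnKC.
  have -> : n`!%:R = 'C(n, j)%:R * j`!%:R * (n - j)`!%:R :> R.
    by rewrite -!natrM -mulnA bin_fact.
  rewrite -natrD subnKC// exprMn -mulr_natr; field.
  by rewrite !fact_neq0 pnatr_eq0 -lt0n bin_gt0 le_jn.
apply: eq_eseriesr => j _; rewrite -nneseriesZl//.
by move=> m _; rewrite lee_fin !(mulr_ge0, divr_ge0, exprn_ge0).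
Qed.

(** The exponential generating series of rooted labelled trees. *)
Definition tree_series x : \bar R :=
  (\sum_(1 <= n <oo) (n%:R ^+ n.-1 / n`!%:R * x ^+ n)%:E)%E.

(** The functional equation T = x exp T of rooted trees, before the second factor
    is known to be an exponential. *)
Lemma tree_seriesE x : 0 <= x -> tree_series x = (x%:E * abel_series 1 x)%E.
Proof.
move=> x0; rewrite /tree_series /abel_series -nneseriesZl; last first.
  by move=> n _; rewrite lee_fin mulr_ge0 ?exprn_ge0// divr_ge0 ?abel_coeff_ge0.
rewrite -nneseries_addn => [|i]; last first.
  by rewrite lee_fin mulr_ge0 ?exprn_ge0// divr_ge0 ?exprn_ge0.
apply: eq_eseriesr => n _; rewrite addn1 -EFinM; congr EFin.
rewrite factS natrM exprS /=.
have -> : abel_coeff 1 n = n.+1%:R ^+ n / n.+1%:R :> R.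
  case: n => [|n]; first by rewrite expr0 divr1.
  by rewrite /= mul1r nat1r exprSr mulfK// pnatr_eq0.
field.
by rewrite fact_neq0 nat1r pnatr_eq0.
Qed.

(** Write A t and G y for the two series. As A s * G y = G (s + y), the values at
    natural numbers are G j = a ^ j * G 0 with a = A 1, and the expansion of G t
    in powers of t sums to G t = exp (t x a) * G 0. But G t = A t * G 0, hence
    A t = exp (t x a). At t = 1 this reads a = exp (x a), that is
    T = x exp T for T = x a. The bound e x < 1 makes G finite, so that G 0 can be
    cancelled. *)
Lemma tree_series_fixpoint x : 0 <= x -> expR 1 * x < 1 ->
  exists T : R, [/\ 0 <= T, tree_series x = T%:E, T * expR (- T) = x &
    forall t, 0 <= t -> abel_series t x = (expR (t * T))%:E].
Proof.
move=> x0 ex1.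
have series_ge0 t : 0 <= t -> (0 <= abel_series t x)%E.
  move=> t0; apply: nneseries_ge0 => n _ _.
  by rewrite lee_fin mulr_ge0 ?exprn_ge0// divr_ge0 ?abel_coeff_ge0.
have power_fin y : 0 <= y -> exists2 g : R, abel_power_series y x = g%:E & 1 <= g.
  move=> y0; have ge1 := abel_power_series_ge1 y0 x0.
  have ltoo := abel_power_series_lty y0 x0 ex1.
  exists (fine (abel_power_series y x)).
    by rewrite fineK// ge0_fin_numE// (le_trans _ ge1).
  by rewrite -lee_fin fineK// ge0_fin_numE// (le_trans _ ge1).
have [g0 g0E g0_ge1] := power_fin 0 (lexx _).
have g0_neq0 : g0 != 0 by rewrite gt_eqF// (lt_le_trans ltr01).
have series_fin t : 0 <= t -> exists2 a : R, 0 <= a & abel_series t x = a%:E.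
  move=> t0; have [g gE _] := power_fin t t0.
  have := abel_seriesM t0 (lexx 0) x0 ex1.
  rewrite addr0 gE g0E => AG.
  have Aoo : (abel_series t x < +oo)%E.
    apply: (@le_lt_trans _ _ g%:E); last by rewrite ltry.
    by rewrite -AG lee_pemulr ?lee_fin ?series_ge0.
  exists (fine (abel_series t x)); first by rewrite fine_ge0 ?series_ge0.
  by rewrite fineK// ge0_fin_numE ?series_ge0.
have [a a0 aE] := series_fin 1 ler01.
have power_nat j : abel_power_series j%:R x = (a ^+ j * g0)%:E.
  elim: j => [|j IH]; first by rewrite mul1r.
  by rewrite -nat1r -abel_seriesM// IH aE -EFinM mulrA -exprS.
have series_exp t : 0 <= t -> abel_series t x = (expR (t * (x * a)))%:E.
  move=> t0; have := abel_seriesM t0 (lexx 0) x0 ex1.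
  have [b b0 bE] := series_fin t t0; rewrite addr0 bE g0E abel_power_series_shift//.
  rewrite (eq_eseriesr (g := fun j => (g0%:E * ((t * (x * a)) ^+ j / j`!%:R)%:E)%E)).
    rewrite nneseriesZl; last first.
      by move=> n _; rewrite lee_fin divr_ge0 ?exprn_ge0 ?mulr_ge0.
    rewrite nneseries_expR ?mulr_ge0// -!EFinM => -[] bg; congr EFin.
    by apply: (mulIf g0_neq0); rewrite bg mulrC.
  move=> j _; rewrite power_nat -!EFinM; congr EFin.
  by rewrite !exprMn; ring.
have aexp : a = expR (x * a).
  by move: aE; rewrite series_exp// mul1r => -[].
exists (x * a); split => //.
- by rewrite mulr_ge0.
- by rewrite tree_seriesE// aE.
- by rewrite {1}aexp -mulrA -expRD subrr expR0 mulr1.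
Qed.

(** This lemma and the next are instances of 1 + h < exp h, with h the difference of
    the two points. *)
Lemma ltr_mulexpRN (a b : R) : 0 < a -> a < b -> b <= 1 ->
  a * expR (- a) < b * expR (- b).
Proof.
move=> a0 ab b1.
have : a < b * expR (- (b - a)).
  have b0 : 0 < b by exact: lt_trans ab.
  apply: (@le_lt_trans _ _ (b * (1 + - (b - a)))); first by nra.
  by rewrite ltr_pM2l// expR_gt1Dx// oppr_eq0 subr_eq0 gt_eqF.
rewrite opprB expRB mulrA ltr_pdivlMr ?expR_gt0// !expRN.
by rewrite ltr_pdivrMr ?expR_gt0// mulrAC ltr_pdivlMr ?expR_gt0.
Qed.

Lemma gtr_mulexpRN (a b : R) : 1 <= a -> a < b -> b * expR (- b) < a * expR (- a).
Proof.
move=> a1 ab.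
have : b < a * expR (b - a).
  have a0 : 0 < a by exact: lt_le_trans a1.
  apply: (@le_lt_trans _ _ (a * (1 + (b - a)))); first by nra.
  by rewrite ltr_pM2l// expR_gt1Dx// subr_eq0 gt_eqF.
rewrite expRB !expRN mulrA ltr_pdivlMr ?expR_gt0// ltr_pdivrMr ?expR_gt0//.
by rewrite mulrAC ltr_pdivlMr ?expR_gt0.
Qed.

Lemma le_tree_series x y : 0 <= x -> x <= y -> (tree_series x <= tree_series y)%E.
Proof.
move=> x0 xy; apply: lee_nneseries => n _.
  by rewrite lee_fin mulr_ge0 ?exprn_ge0// divr_ge0 ?exprn_ge0.
rewrite lee_fin ler_wpM2l ?divr_ge0 ?exprn_ge0//.
by rewrite lerXn2r// nnegrE// (le_trans x0).
Qed.

(** The equation T exp (- T) = x has a second root, beyond 1. It decreases with x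
    while the series increases, so the series cannot take it at both x and y. *)
Lemma tree_series_le1 x : 0 <= x -> expR 1 * x < 1 -> (tree_series x <= 1)%E.
Proof.
move=> x0 ex1; have [T [T0 TE Tx _]] := tree_series_fixpoint x0 ex1.
rewrite TE lee_fin leNgt; apply/negP => T1.
(* Any point between x and the radius of convergence 1 / e would do. *)
pose y := (x + expR (- 1)) / 2.
have x1 : x < expR (- 1) by rewrite expRN -[_^-1]mul1r ltr_pdivlMr ?expR_gt0 1?mulrC.
have xy : x < y by rewrite /y; lra.
have ey1 : expR 1 * y < 1.
  by rewrite mulrC -ltr_pdivlMr ?expR_gt0// div1r -expRN /y; lra.
have [V [V0 VE Vy _]] := tree_series_fixpoint (le_trans x0 (ltW xy)) ey1.
have := le_tree_series x0 (ltW xy); rewrite TE VE lee_fin le_eqVlt => /orP[/eqP TV|TV].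
  by move: xy; rewrite -Tx -Vy TV ltxx.
by have := gtr_mulexpRN (ltW T1) TV; rewrite Tx Vy ltNge (ltW xy).
Qed.

Lemma mulexpRN_lt1 u : 0 <= u -> u < 1 -> expR 1 * (u * expR (- u)) < 1.
Proof.
rewrite le_eqVlt => /orP[/eqP <-|u0] u1; first by rewrite mul0r mulr0.
have := ltr_mulexpRN u0 u1 (lexx _); rewrite mul1r => u_lt.
by rewrite mulrC -ltr_pdivlMr ?expR_gt0// div1r -expRN.
Qed.

(** Both the sum at u exp (- u) and u itself are roots of the same equation, at most
    1, where u exp (- u) is injective. *)
Lemma tree_series_abel u : 0 <= u -> u < 1 ->
  tree_series (u * expR (- u)) = u%:E /\
  forall t, 0 <= t -> abel_series t (u * expR (- u)) = (expR (t * u))%:E.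
Proof.
move=> u0 u1; have x0 : 0 <= u * expR (- u) by rewrite mulr_ge0 ?expR_ge0.
have ex1 := mulexpRN_lt1 u0 u1.
have [T [T0 TE Tx AE]] := tree_series_fixpoint x0 ex1.
have T1 := tree_series_le1 x0 ex1; rewrite TE lee_fin in T1.
suff Tu : T = u by split=> [|t t0]; rewrite ?TE ?AE// Tu.
move: T0; rewrite le_eqVlt => /orP[/eqP T0|T0].
  move/eqP: Tx; rewrite -T0 mul0r eq_sym mulf_eq0 expR_eq0 orbF => /eqP ->.
  by [].
have {}u0 : 0 < u.
  by rewrite -(pmulr_lgt0 _ (expR_gt0 (- u))) -Tx mulr_gt0 ?expR_gt0.
case: (ltgtP T u) => // [Tu|uT].
  by have := ltr_mulexpRN T0 Tu (ltW u1); rewrite Tx ltxx.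
by have := ltr_mulexpRN u0 uT T1; rewrite Tx ltxx.
Qed.

(** Convergence at the radius 1 / e, which the critical case c = 1 needs. The
    partial sums are polynomials bounded by 1 to the left of 1 / e, hence at 1 / e
    by continuity; from below, the sum dominates every u < 1 by monotonicity. *)
Lemma tree_series_expRN1 : tree_series (expR (- 1)) = 1%E.
Proof.
have e0 : 0 < expR (- 1) :> R := expR_gt0 _.
have le1 : (tree_series (expR (- 1)) <= 1)%E.
  apply: lime_le; first by apply: is_cvg_nneseries => n _ _;
    rewrite lee_fin mulr_ge0 ?exprn_ge0 ?expR_ge0// divr_ge0 ?exprn_ge0.
  apply: nearW => N; rewrite sumEFin lee_fin.
  pose c n : R := if (0 < n)%N then n%:R ^+ n.-1 / n`!%:R else 0.
  pose p : {poly R} := \poly_(n < N) c n.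
  have pE x : \sum_(1 <= n < N) n%:R ^+ n.-1 / n`!%:R * x ^+ n = p.[x].
    rewrite horner_poly -(big_mkord xpredT (fun n => c n * x ^+ n)).
    case: N {p} => [|N]; first by rewrite !big_geq.
    rewrite [RHS]big_nat_recl// /c ltnn mul0r add0r big_add1 /=.
    by apply: eq_big_nat => n _.
  rewrite pE.
  have := cvg_at_left_filter (@continuous_horner R p (expR (- 1))).
  move=> /cvgr_to_le; apply; near=> y.
  have y0 : 0 <= y by near: y; exact: nbhs_left_ge.
  have ey1 : expR 1 * y < 1.
    by rewrite mulrC -ltr_pdivlMr ?expR_gt0// div1r -expRN; near: y; exact: nbhs_left_lt.
  rewrite -[leLHS]/(p.[y]) -pE -lee_fin -sumEFin.
  apply: le_trans (tree_series_le1 y0 ey1); apply: nneseries_lim_ge => n _ _.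
  by rewrite lee_fin mulr_ge0 ?exprn_ge0// divr_ge0 ?exprn_ge0.
apply/eqP; rewrite eq_le le1/=.
have ge_u u : 0 <= u -> u < 1 -> (u%:E <= tree_series (expR (- 1)))%E.
  move=> u0 u1; have [<- _] := tree_series_abel u0 u1.
  apply: le_tree_series; first by rewrite mulr_ge0 ?expR_ge0.
  by rewrite (expRN 1) -[_^-1]mul1r ler_pdivlMr ?expR_gt0// mulrC ltW ?mulexpRN_lt1.
have fin : tree_series (expR (- 1)) \is a fin_num.
  by rewrite ge0_fin_numE ?ge_u// (le_lt_trans le1)// ltry.
move: ge_u le1; rewrite -(fineK fin); set v := fine _ => ge_u.
rewrite !lee_fin => v1; rewrite leNgt; apply/negP => v_lt1.
have v0 : 0 <= v by rewrite -lee_fin ge_u.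
by have := ge_u ((v + 1) / 2); rewrite lee_fin; lra.
Unshelve. all: by end_near. Qed.

Lemma tree_series_inverse u : 0 <= u -> u <= 1 ->
  tree_series (u * expR (- u)) = u%:E.
Proof.
move=> u0; rewrite le_eqVlt => /orP[/eqP ->|u1].
  by rewrite mul1r tree_series_expRN1.
by have [] := tree_series_abel u0 u1.
Qed.

End tree_function.

(** * The principal branch of the Lambert function *)

Section lambert.
Context {R : realType}.
Implicit Types (c u x z : R).

Lemma mulexpRN_le c : 0 < c -> c * expR (- c) <= expR (- 1).
Proof.
move=> c0; have [c1|c1|->] := ltgtP c 1; last by rewrite mul1r.
  by have := ltr_mulexpRN c0 c1 (lexx _); rewrite mul1r => /ltW.
by have := gtr_mulexpRN (lexx _) c1; rewrite mul1r => /ltW.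
Qed.

(** On negative arguments the principal branch is minus the inverse of the
    increasing part of u exp (- u), so that the whole discussion takes place with
    positive numbers u = - W. *)
Lemma lambertW0_mulexpRN u : 0 < u -> u <= 1 ->
  lambertW0 (- (u * expR (- u))) = - u.
Proof.
move=> u0 u1; rewrite /lambertW0; case: xgetP => [w _ [w1 wE]|]; last first.
  by move=> /(_ (- u))/=; case; rewrite lerN2 mulNr.
set v := - w.
have v1 : v <= 1 by rewrite lerNl.
have vu : v * expR (- v) = u * expR (- u) by rewrite /v opprK mulNr wE opprK.
have v0 : 0 < v.
  by rewrite -(pmulr_lgt0 _ (expR_gt0 (- v))) vu mulr_gt0 ?expR_gt0.
apply: oppr_inj; rewrite opprK -/v; case: (ltgtP v u) => // [lt_vu|lt_uv].
  by have := ltr_mulexpRN v0 lt_vu u1; rewrite vu ltxx.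
by have := ltr_mulexpRN u0 lt_uv v1; rewrite vu ltxx.
Qed.

Lemma mulexpRN_surj x : 0 < x -> x <= expR (- 1) ->
  exists u, [/\ 0 < u, u <= 1 & u * expR (- u) = x].
Proof.
move=> x0 x1.
have cf : continuous (fun u : R => u * expR (- u)).
  move=> u; apply: cvgM; first exact: cvg_id.
  apply: (continuous_comp (f := -%R)); last exact: continuous_expR.
  exact: continuousN.
have [|u] := @IVT R (fun u => u * expR (- u)) 0 1 x ler01 (continuous_subspaceT cf).
  by rewrite mul0r mul1r minEle maxEle expR_ge0 (ltW x0).
rewrite in_itv/= => /andP[u0 u1] ux; exists u; split => //.
by rewrite -(pmulr_lgt0 _ (expR_gt0 (- u))) ux.
Qed.

Lemma lambertW0N x : 0 < x -> x <= expR (- 1) ->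
  exists u, [/\ 0 < u, u <= 1, u * expR (- u) = x & lambertW0 (- x) = - u].
Proof.
move=> x0 x1; have [u [u0 u1 ux]] := mulexpRN_surj x0 x1.
by exists u; split => //; rewrite -ux lambertW0_mulexpRN.
Qed.

End lambert.

(** * Laplace transforms of measures carried by the natural numbers *)

Section natural_numbers.
Context {R : realType}.

Lemma measurable_nats : measurable [set x : R | exists n : nat, x = n%:R].
Proof.
rewrite (_ : [set x | _] = \bigcup_n [set n%:R]).
  exact: bigcup_measurable.
by apply/seteqP; split => x /= [n]; [move=> ->|move=> _ ->]; exists n.
Qed.

Lemma measurable_posn :
  measurable [set x : R | exists n : nat, (0 < n)%N /\ x = n%:R].
Proof.
rewrite (_ : [set x | _] = \bigcup_(n in [set n | (0 < n)%N]) [set n%:R]).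
  exact: bigcup_measurable.
by apply/seteqP; split => x /= [n]; [move=> [n0 ->]|move=> n0 ->]; exists n.
Qed.

End natural_numbers.

Section laplace_uniqueness.
Context {R : realType} (mu : {measure set R -> \bar R}).
Implicit Types (E : set R) (a K z x : R) (r : nat -> R).

Lemma measurable_expRN z E :
  measurable_fun E (fun x => (expR (- z * x))%:E).
Proof.
apply/measurable_EFinP; apply: measurable_funTS.
apply: measurableT_comp => //; exact: measurable_funM.
Qed.

Lemma cvg_expRN_natr K a : 0 < a -> (K * expR (- (n%:R * a)))%:E @[n --> \oo] --> 0%E.
Proof.
move=> a0; apply/cvg_EFin; first exact: nearW.
rewrite -[X in _ --> X](mulr0 K) /=; apply: cvgM; first exact: cvg_cst.
under eq_cvg do rewrite -mulrN expRM_natl.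
apply: cvg_expr; rewrite ger0_norm ?expR_ge0//.
by rewrite expR_lt1 oppr_lt0.
Qed.

(** A positive mass on ]-oo, a - 1 / j] would contribute at least a multiple of
    exp (- m (a - 1 / j)), which exceeds K exp (- m a) for large m. *)
Lemma exponential_decay_null E z a K : measurable E -> 0 <= z ->
  (forall m : nat, (\int[mu]_(x in E) (expR (- (z + m%:R) * x))%:E <=
     (K * expR (- (m%:R * a)))%:E)%E) ->
  mu (E `&` `]-oo, a[) = 0%E.
Proof.
move=> mE z0 decay.
pose B j := E `&` `]-oo, a - j.+1%:R^-1].
have mB j : measurable (B j) by apply: measurableI.
have muB j : mu (B j) = 0%E.
  apply/eqP; rewrite eq_le measure_ge0 andbT.
  have j0 : 0 < j.+1%:R^-1 :> R by rewrite invr_gt0.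
  apply: (cvge_to_ge (@cvg_expRN_natr (K * expR (z * a)) _ j0)).
  apply: nearW => m.
  pose k := expR (- (z * a)) * expR (- (m%:R * (a - j.+1%:R^-1))).
  have k0 : 0 < k by rewrite mulr_gt0 ?expR_gt0.
  have : (k%:E * mu (B j) <= (K * expR (- (m%:R * a)))%:E)%E.
    apply: le_trans (decay m); rewrite -integral_cst//.
    apply: (@le_trans _ _ (\int[mu]_(x in B j) (expR (- (z + m%:R) * x))%:E)%E).
      apply: ge0_le_integral => //.
      - by move=> x _; rewrite lee_fin ltW.
      - exact: measurable_expRN.
      - move=> x [_]; rewrite /= in_itv/= => xa.
        rewrite lee_fin /k -expRD ler_expR.
        have xa' : x <= a by rewrite (le_trans xa)// gerBl ltW.
        have h1 : z * x <= z * a by rewrite ler_wpM2l.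
        have h2 : m%:R * x <= m%:R * (a - j.+1%:R^-1) by rewrite ler_wpM2l.
        by rewrite mulNr mulrDl -opprD lerN2 lerD.
    apply: ge0_subset_integral => //; last by move=> x [].
    exact: measurable_expRN.
  rewrite -lee_pdivlMl// => /le_trans; apply; rewrite -EFinM lee_fin.
  rewrite le_eqVlt; apply/orP; left; apply/eqP.
  rewrite /k invfM -!expRN !opprK mulrBr (expRD (m%:R * a)).
  rewrite !(expRN (_ * a)) !(expRN (_ * _^-1)).
  field.
  by rewrite !gt_eqF ?expR_gt0.
have -> : E `&` `]-oo, a[ = \bigcup_j B j.
  rewrite -setI_bigcupr; congr (_ `&` _); apply/seteqP; split => x /=.
    rewrite in_itv/= => xa.
    have [j] := ltr_add_invr xa.
    by exists j => //=; rewrite in_itv/= lerBrDr ltW.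
  move=> [j _]/=; rewrite !in_itv/= => /le_lt_trans; apply.
  by rewrite gtrBl invr_gt0.
apply: measure_negligible; first exact: bigcup_measurable.
by apply: negligible_bigcup => j; exists (B j); split.
Qed.

(** With nothing left below a, the weights exp (m a) exp (- m x) are at most 1 and
    tend to the indicator of a: dominated convergence isolates the atom. *)
Lemma exponential_weight_limit E z a : measurable E ->
  (\int[mu]_(x in E) (expR (- z * x))%:E < +oo)%E ->
  mu (E `&` `]-oo, a[) = 0%E ->
  ((expR (m%:R * a))%:E * \int[mu]_(x in E) (expR (- (z + m%:R) * x))%:E
     @[m --> \oo] --> (expR (- z * a))%:E * mu (E `&` [set a]))%E.
Proof.
move=> mE fin null.
pose D := E `\` (E `&` `]-oo, a[).
have mN : measurable (E `&` `]-oo, a[) by apply: measurableI.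
have mD : measurable D by apply: measurableD.
have aD x : D x -> a <= x.
  by case=> Ex /not_andP[//|/=]; rewrite in_itv/= => /negP; rewrite -leNgt.
have restrict z' : (\int[mu]_(x in E) (expR (- z' * x))%:E =
    \int[mu]_(x in D) (expR (- z' * x))%:E)%E.
  by apply: ge0_negligible_integral => //; exact: measurable_expRN.
pose f (m : nat) x := ((expR (m%:R * a))%:E * (expR (- (z + m%:R) * x))%:E)%E.
have -> : (fun m : nat => (expR (m%:R * a))%:E *
    \int[mu]_(x in E) (expR (- (z + m%:R) * x))%:E)%E =
    (fun m => \int[mu]_(x in D) f m x)%E.
  apply/funext => m; rewrite restrict ge0_integralZl//; exact: measurable_expRN.
have -> : ((expR (- z * a))%:E * mu (E `&` [set a]) =
   \int[mu]_(x in D) ((expR (- z * a))%:E * (\1_[set a] x)%:E))%E.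
  rewrite ge0_integralZl//; last by apply/measurable_EFinP; exact: measurable_indic.
  rewrite integral_indic//; congr (_ * mu _)%E; apply/seteqP; split => x /=.
    move=> [Ex xa]; rewrite xa in Ex *; split => //.
    by split => // -[_] /=; rewrite in_itv/= ltxx.
  by move=> [xa [Ex _]].
have mf m : measurable_fun D (f m).
  by apply: emeasurable_funM => //; exact: measurable_expRN.
have fE m x : f m x = (expR (- z * x) * expR (- (m%:R * (x - a))))%:E.
  by rewrite /f -EFinM -!expRD; congr (expR _)%:E; ring.
have int : mu.-integrable D (fun x => (expR (- z * x))%:E).
  apply/integrableP; split; first exact: measurable_expRN.
  under eq_integral do rewrite gee0_abs ?lee_fin ?expR_ge0//.
  by rewrite -restrict.
have mlim : measurable_fun D
    (fun x => (expR (- z * a))%:E * (\1_[set a] x)%:E)%E.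
  apply: measurable_funeM; apply/measurable_EFinP; exact: measurable_indic.
suff [+ +] : {ae mu, forall x, D x -> f ^~ x @ \oo -->
      ((expR (- z * a))%:E * (\1_[set a] x)%:E)%E} /\
    {ae mu, forall x m, D x -> (`|f m x| <= (expR (- z * x))%:E)%E}.
  by move=> cvf domf; have [] := dominated_convergence mD mf mlim cvf int domf.
split.
- apply: aeW => x Dx.
  have := aD _ Dx; rewrite le_eqVlt => /orP[/eqP ax|ax].
    rewrite indicE mem_set// -EFinM mulr1.
    have -> : f^~ x = cst (expR (- z * a))%:E.
      apply/funext => m; rewrite fE -ax subrr mulr0 oppr0 expR0 mulr1.
      by [].
    exact: cvg_cst.
  rewrite indicE memNset; last by move=> xa; rewrite xa ltxx in ax.
  rewrite -EFinM mulr0; under eq_fun do rewrite fE.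
  by apply: cvg_expRN_natr; rewrite subr_gt0.
- apply: aeW => x m Dx; rewrite fE gee0_abs; last first.
    by rewrite lee_fin mulr_ge0 ?expR_ge0.
  rewrite lee_fin ler_piMr ?expR_ge0// expR_le1 oppr_le0 mulr_ge0// subr_ge0.
  exact: aD.
Qed.

(** One atom is peeled off. The series starts at n, so the transform is
    O(exp (- m n)) and there is no mass below n; its rescaled limit is the mass of
    n; and without this atom the same situation holds with n + 1 on ]n, +oo[. *)
Lemma laplace_series_step E z r n : measurable E -> 0 <= z ->
  (forall k, 0 <= r k) -> (\sum_(0 <= k <oo) (r k)%:E < +oo)%E ->
  (forall m : nat, (\int[mu]_(x in E) (expR (- (z + m%:R) * x))%:E =
     \sum_(n <= k <oo) (r k * expR (- (m%:R * k%:R)))%:E)%E) ->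
  [/\ mu (E `&` `]-oo, n%:R[) = 0%E,
      mu (E `&` [set n%:R]) = (r n * expR (z * n%:R))%:E &
      forall m : nat,
       (\int[mu]_(x in E `&` `]n%:R, +oo[) (expR (- (z + m%:R) * x))%:E =
        \sum_(n.+1 <= k <oo) (r k * expR (- (m%:R * k%:R)))%:E)%E].
Proof.
move=> mE z0 r0 rfin laplace.
have term0 m k : (0 <= (r k * expR (- (m%:R * k%:R)))%:E)%E.
  by rewrite lee_fin mulr_ge0 ?expR_ge0.
(* The constant is the sum of the remaining coefficients. *)
have tail j : exists2 C : R, 0 <= C & forall m,
    (\sum_(j <= k <oo) (r k * expR (- (m%:R * k%:R)))%:E <=
      (C * expR (- (m%:R * j%:R)))%:E)%E.
  have C0 : (0 <= \sum_(j <= k <oo) (r k)%:E)%E.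
    by apply: nneseries_ge0 => k _ _; rewrite lee_fin.
  have Cfin : (\sum_(j <= k <oo) (r k)%:E)%E \is a fin_num.
    rewrite ge0_fin_numE//; apply: le_lt_trans rfin.
    rewrite [leRHS](nneseries_split 0 j) => [|k _]; last by rewrite lee_fin.
    by rewrite add0n leeDr// sume_ge0// => k _; rewrite lee_fin.
  exists (fine (\sum_(j <= k <oo) (r k)%:E)%E); first exact: fine_ge0.
  move=> m; rewrite mulrC EFinM fineK// -nneseriesZl; last first.
    by move=> k _; rewrite lee_fin.
  rewrite ereal_series [leRHS]ereal_series; apply: lee_nneseries => [//|k jk].
  rewrite -EFinM lee_fin mulrC ler_wpM2r// ler_expR lerN2.
  by rewrite ler_wpM2l// ler_nat.
have head m : (\sum_(n <= k <oo) (r k * expR (- (m%:R * k%:R)))%:E =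
    (r n * expR (- (m%:R * n%:R)))%:E +
    \sum_(n.+1 <= k <oo) (r k * expR (- (m%:R * k%:R)))%:E)%E.
  by rewrite (nneseries_split n 1)// addn1 big_nat1.
have [C C0 Cle] := tail n; have [C' C'0 C'le] := tail n.+1.
have null : mu (E `&` `]-oo, n%:R[) = 0%E.
  by apply: (@exponential_decay_null E z n%:R C) => // m; rewrite laplace.
have mass : mu (E `&` [set n%:R]) = (r n * expR (z * n%:R))%:E.
  have lim := exponential_weight_limit (a := n%:R) mE _ null.
  have {lim} := lim z; rewrite -{1}[z]addr0 -[X in z + X]/(0%:R) laplace.
  move=> /(_ (le_lt_trans (Cle 0%N) (ltry _))) lim.
  have lim' : ((expR (m%:R * n%:R))%:E * \int[mu]_(x in E)
      (expR (- (z + m%:R) * x))%:E @[m --> \oo] --> (r n)%:E)%E.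
    apply: (@squeeze_cvge _ _ _ _ (cst (r n)%:E) _
        (fun m => (r n)%:E + (C' * expR (- (m%:R * 1)))%:E)%E).
    - apply: nearW => m; rewrite /= laplace head ge0_muleDr//; last first.
        by apply: nneseries_ge0.
      rewrite -EFinM mulrCA -expRD subrr expR0 (mulr1 (r n)); apply/andP; split.
        apply: leeDl; rewrite mule_ge0 ?lee_fin ?expR_ge0//.
        by apply: nneseries_ge0.
      rewrite leeD2l// muleC -lee_pdivlMr ?expR_gt0//; apply: le_trans (C'le m) _.
      rewrite -EFinM lee_fin -expRN -mulrA -expRD.
      by rewrite -opprD -mulrDr nat1r.
    - exact: cvg_cst.
    - rewrite -[X in _ --> X]adde0; apply: cvgeD => //; first exact: cvg_cst.
      exact: cvg_expRN_natr.
  have := cvg_unique _ lim lim'; move/(_ (@ereal_hausdorff R)) => massE.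
  have e0 : 0 < expR (z * n%:R) by exact: expR_gt0.
  rewrite [in RHS]mulrC EFinM -massE muleA -EFinM -expRD mulNr subrr expR0.
  by rewrite mul1e.
split=> // m.
have mA : measurable (E `&` [set n%:R]) by apply: measurableI.
have mB : measurable (E `&` `]n%:R, +oo[) by apply: measurableI.
have := laplace m; rewrite (ge0_negligible_integral _ _ _ _ null)//; last 2 first.
- by apply: measurableI.
- exact: measurable_expRN.
have -> : E `\` (E `&` `]-oo, n%:R[) =
    (E `&` [set n%:R]) `|` (E `&` `]n%:R, +oo[).
  rewrite -setIUr setDIr setDv set0U setDE; congr (_ `&` _).
  apply/seteqP; split => x /=; rewrite !in_itv/= ?andbT.
    move/negP; rewrite -leNgt le_eqVlt => /orP[/eqP ->|]; [by left|by right].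
  by move=> [->|nx]; apply/negP; rewrite -leNgt// ltW.
rewrite ge0_integral_setU//; last 2 first.
- exact: measurable_expRN.
- rewrite disj_set2E; apply/eqP/seteqP; split => x //= [[_ ->] [_]].
  by rewrite in_itv/= ltxx.
rewrite head.
have -> : (\int[mu]_(x in E `&` [set n%:R]) (expR (- (z + m%:R) * x))%:E =
    (r n * expR (- (m%:R * n%:R)))%:E)%E.
  rewrite (eq_integral (cst (expR (- (z + m%:R) * n%:R))%:E)); last first.
    by move=> x; rewrite inE => -[_ ->].
  rewrite integral_cst// mass -EFinM; congr EFin.
  rewrite mulrC -mulrA -expRD; congr (_ * expR _); ring.
set q := (r n * _)%:E => sumE.
by rewrite -[LHS](@addeK _ q)// [X in (X - _)%E]addeC sumE [X in (X - _)%E]addeC addeK.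
Qed.

(** Uniqueness of the Laplace transform for measures on the natural numbers, by
    peeling off the atoms 0, 1, 2 and so on, which leaves nothing between them. The
    base point z is kept free because the transform of the process is known at
    positive arguments only: at 0 the critical case c = 1 would meet the
    boundary of the disc of convergence. *)
Lemma laplace_series_unique E z r : measurable E -> 0 <= z ->
  (forall k, 0 <= r k) -> (\sum_(0 <= k <oo) (r k)%:E < +oo)%E ->
  (forall m : nat, (\int[mu]_(x in E) (expR (- (z + m%:R) * x))%:E =
     \sum_(0 <= k <oo) (r k * expR (- (m%:R * k%:R)))%:E)%E) ->
  (forall n, mu (E `&` [set n%:R]) = (r n * expR (z * n%:R))%:E) /\
  mu (E `\` [set x | exists n : nat, x = n%:R]) = 0%E.
Proof.
move=> mE z0 r0 rfin laplace.
pose F n := if n is n'.+1 then E `&` `]n'%:R, +oo[ else E.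
have mF n : measurable (F n) by case: n => //= n; apply: measurableI.
have FS n : F n `&` `]n%:R, +oo[ = F n.+1.
  case: n => //= n; rewrite -setIA; congr (_ `&` _).
  apply/seteqP; split => x /=; rewrite !in_itv/= !andbT; first by case.
  by move=> nx; split => //; rewrite (lt_trans _ nx)// ltr_nat.
have laplaceF n m : (\int[mu]_(x in F n) (expR (- (z + m%:R) * x))%:E =
     \sum_(n <= k <oo) (r k * expR (- (m%:R * k%:R)))%:E)%E.
  elim: n m => [|n IH] m; first exact: laplace.
  by have [_ _] := laplace_series_step (mF n) z0 r0 rfin IH; rewrite FS; apply.
have step n := laplace_series_step (mF n) z0 r0 rfin (laplaceF n).
split=> [n|].
  have [_ + _] := step n; suff -> : F n `&` [set n%:R] = E `&` [set n%:R] by [].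
  case: n => //= n; rewrite -setIA; congr (_ `&` _).
  apply/seteqP; split => x /=; first by case.
  by move=> ->; rewrite in_itv/= andbT ltr_nat.
apply: (@subset_measure0 _ _ _ mu _ (\bigcup_n (F n `&` `]-oo, n%:R[))).
- by apply: measurableD => //; exact: measurable_nats.
- by apply: bigcup_measurable => n _; apply: measurableI.
- move=> x [Ex nx].
  have [n] : exists n : nat, x < n%:R.
    by exists (Num.truncn x).+1; rewrite truncnS_gt.
  elim: n => [|n IH] xn; first by exists 0%N => //; split => //=; rewrite in_itv.
  have [/IH//|xn'|xn'] := ltgtP x n%:R; last by exfalso; apply: nx; exists n.
  exists n.+1 => //; split => /=; last by rewrite in_itv.
  by split => //; rewrite in_itv/= xn'.
- apply: measure_negligible.
    by apply: bigcup_measurable => n _; apply: measurableI.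
  apply: negligible_bigcup => n; exists (F n `&` `]-oo, n%:R[); split => //.
    exact: measurableI.
  by have [] := step n.
Qed.

End laplace_uniqueness.

(** * Disjoint subfamilies of an independent family *)

Lemma bigcap_seq_eqType {T : Type} {I : eqType} (s : seq I) (F : I -> set T) :
  \bigcap_(i in [set` s]) F i = \big[setI/setT]_(i <- s) F i.
Proof.
elim: s => [|i s IH]; first by rewrite big_nil; apply/seteqP; split => // w _ i.
rewrite big_cons -IH; apply/seteqP; split => [w sw|w [Fi sw] j /=].
  by split => [|j /= js]; apply: sw; rewrite /= inE ?eqxx// js orbT.
by rewrite inE => /orP[/eqP ->//|]; exact: sw.
Qed.

Section independence.
Context {d : measure_display} {T : measurableType d} {R : realType}
  (P : probability T R) {I : eqType} (X : I -> {RV P >-> R}).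
Implicit Types (J : set I) (E : set T).

(** The events that depend on finitely many members of J: a pi-system that
    generates the sigma-algebra of the subfamily. *)
Definition cylinders J : set (set T) := [set E | exists (s : seq I) (A : I -> set R),
  [/\ uniq s, {subset s <= [pred i | `[< J i >]]}, (forall i, measurable (A i)) &
      E = \bigcap_(i in [set` s]) (X i @^-1` A i)]].

(** The sample space with the sigma-algebra of the subfamily J: a function of this
    subfamily is a function measurable from this type. *)
Definition family_sigma J := g_sigma_algebraType (cylinders J).

Lemma cylinders_setI J : setI_closed (cylinders J).
Proof.
move=> _ _ [s [A [us sJ mA ->]]] [s' [A' [us' s'J mA' ->]]].
exists (undup (s ++ s')), (fun i => (if i \in s then A i else setT) `&`
  (if i \in s' then A' i else setT)); split.
- exact: undup_uniq.
- by move=> i; rewrite mem_undup mem_cat => /orP[/sJ|/s'J].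
- by move=> i; apply: measurableI; case: ifP.
- apply/seteqP; split => [w [sw s'w] i /=|w sw].
    by rewrite mem_undup => _; split; case: ifPn => // ?; [exact: sw|exact: s'w].
  split => i /= i_s; have := sw i; rewrite /= mem_undup mem_cat i_s ?orbT.
    by move=> /(_ erefl)[].
  by move=> /(_ erefl)[].
Qed.

Lemma cylindersT J : cylinders J setT.
Proof.
exists [::], (fun=> setT); split => //.
by apply/seteqP; split => // w _ i.
Qed.

Lemma cylinders_measurable J : cylinders J `<=` measurable.
Proof.
move=> _ [s [A [_ _ mA ->]]]; rewrite bigcap_seq_eqType.
apply: big_rec => // i E _ mE; apply: measurableI => //.
by rewrite -[_ @^-1` _]setTI; exact: measurable_funP.
Qed.

Lemma family_sigma_measurable J E : <<s cylinders J >> E -> measurable E.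
Proof.
by apply: smallest_sub => //; [exact: sigma_algebra_measurable|
  exact: cylinders_measurable].
Qed.

Lemma measurable_family_member J i : J i ->
  measurable_fun setT (X i : family_sigma J -> R).
Proof.
move=> Ji _ B mB; rewrite setTI; apply: sub_sigma_algebra.
exists [:: i], (fun=> B); split => //.
  by move=> j; rewrite inE => /eqP ->; apply/asboolP.
by rewrite bigcap_seq_eqType big_seq1.
Qed.

Lemma measurable_family_sigma J (f : T -> R) :
  measurable_fun setT (f : family_sigma J -> R) -> measurable_fun setT f.
Proof.
move=> mf mT B mB; apply: (@family_sigma_measurable J).
exact: (mf measurableT B mB).
Qed.

Hypothesis indX : mutually_independent X.

Lemma cylinders_independent J1 J2 E1 E2 : J1 `&` J2 = set0 ->
  cylinders J1 E1 -> cylinders J2 E2 -> P (E1 `&` E2) = (P E1 * P E2)%E.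
Proof.
move=> J12 [s1 [A1 [u1 s1J mA1 ->]]] [s2 [A2 [u2 s2J mA2 ->]]].
pose A i := if i \in s1 then A1 i else A2 i.
have mA i : measurable (A i) by rewrite /A; case: ifP.
have s12 i : i \in s2 -> i \in s1 = false.
  move=> is2; apply/negP => is1; have : (J1 `&` J2) i.
    by split; apply/asboolP; [exact: s1J|exact: s2J].
  by rewrite J12.
have u12 : uniq (s1 ++ s2).
  rewrite cat_uniq u1 u2 andbT; apply/hasPn => i is2.
  by rewrite /= s12.
have E1E : \bigcap_(i in [set` s1]) (X i @^-1` A1 i) =
    \big[setI/setT]_(i <- s1) (X i @^-1` A i).
  by rewrite -bigcap_seq_eqType; apply: eq_bigcapr => i /= is1; rewrite /A is1.
have E2E : \bigcap_(i in [set` s2]) (X i @^-1` A2 i) =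
    \big[setI/setT]_(i <- s2) (X i @^-1` A i).
  by rewrite -bigcap_seq_eqType; apply: eq_bigcapr => i /= is2; rewrite /A s12.
by rewrite E1E E2E -big_cat !indX// big_cat.
Qed.

(** For C fixed, P (E `&` C) and P E * P C are finite measures in E which agree on
    the pi-system of cylinders. *)
Lemma cylinder_family_sigma_independent J E (C : set T) :
  (forall B, cylinders J B -> P (B `&` C) = (P B * P C)%E) -> measurable C ->
  <<s cylinders J >> E -> P (E `&` C) = (P E * P C)%E.
Proof.
move=> cylC mC sE.
have PC : P C = (fine (P C))%:E by rewrite fineK// fin_num_measure.
pose m2 := mscale (NngNum (fine_ge0 (measure_ge0 P C))) P.
have m2E B : m2 B = (P B * P C)%E by rewrite /m2 /mscale/= muleC [in RHS]PC.
rewrite -m2E -/(mrestr P mC E).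
apply: (@g_sigma_algebra_measure_unique _ _ _ (cylinders J)
  (@cylinders_measurable J) (fun=> setT) (fun=> @cylindersT J) _
  (mrestr P mC) m2 (@cylinders_setI J) _ _ E sE).
- by apply/seteqP; split => // w _; exists 0%N.
- by move=> B /cylC BC; rewrite [RHS]m2E.
- move=> k; apply: (@le_lt_trans _ _ 1%E); last exact: ltry.
  exact: (probability_le1 P (measurableI _ _ measurableT mC)).
Qed.

(** Disjoint subfamilies generate independent sigma-algebras: cylinders are replaced
    by arbitrary events first on one side, then on the other. *)
Lemma family_sigma_independent J1 J2 E1 E2 : J1 `&` J2 = set0 ->
  <<s cylinders J1 >> E1 -> <<s cylinders J2 >> E2 ->
  P (E1 `&` E2) = (P E1 * P E2)%E.
Proof.
move=> J12 sE1 sE2.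
apply: (cylinder_family_sigma_independent (J := J1)) => //; last first.
  exact: family_sigma_measurable sE2.
move=> B cB; rewrite setIC muleC.
apply: (cylinder_family_sigma_independent (J := J2)) => //; last first.
  exact: cylinders_measurable cB.
by move=> C cC; rewrite setIC muleC; exact: cylinders_independent J12 cB cC.
Qed.

End independence.

Section independent_pair.
Context {d : measure_display} {T : measurableType d} {R : realType}
  (P : probability T R) (Z W : T -> R).
Hypotheses (mZ : measurable_fun setT Z) (mW : measurable_fun setT W).
Hypothesis indZW : forall A B : set R, measurable A -> measurable B ->
  P (Z @^-1` A `&` W @^-1` B) = (P (Z @^-1` A) * P (W @^-1` B))%E.
Local Open Scope ereal_scope.

Let mZW : measurable_fun setT (fun w => (Z w, W w)) := measurable_fun_pair mZ mW.

Let Zrv : {RV P >-> R} := HB.pack Z (isMeasurableFun.Build _ _ _ _ _ mZ).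
Let Wrv : {RV P >-> R} := HB.pack W (isMeasurableFun.Build _ _ _ _ _ mW).
Let ZWrv : {mfun T >-> (R * R)%type} :=
  HB.pack (fun w => (Z w, W w)) (isMeasurableFun.Build _ _ _ _ _ mZW).

(** The joint law of an independent pair is the product of its laws, to which
    Tonelli's theorem applies. *)
Lemma ge0_integral_independent_pair (f : R * R -> \bar R) :
  measurable_fun setT f -> (forall p, 0 <= f p) ->
  \int[P]_w f (Z w, W w) = \int[P]_x \int[P]_y f (Z x, W y).
Proof.
move=> mf f0.
have := @ge0_integral_pushforward _ _ T (R * R)%type R _ mZW P setT f measurableT mf.
rewrite preimage_setT /= => <- //.
rewrite (eq_measure_integral (distribution P Zrv \x distribution P Wrv))//.
  rewrite fubini_tonelli1//= /fubini_F.
  rewrite (@ge0_integral_pushforward _ _ T R R _ mZ P setT)//=.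
  - apply: eq_integral => x _ /=.
    rewrite (@ge0_integral_pushforward _ _ T R R _ mW P setT)//=.
    exact: measurable_fun_pair2.
  - exact: (measurable_fun_fubini_tonelli_F (m2 := distribution P Wrv)).
  - by move=> x _; apply: integral_ge0.
move=> A mA _; symmetry; apply: (@product_measure_unique _ _ _ _ _
  (distribution P Zrv) (distribution P Wrv) (distribution P ZWrv)) => //.
Qed.

Lemma ge0_integral_independentM (g h : R -> R) :
  measurable_fun setT g -> measurable_fun setT h ->
  (forall x, 0 <= g x)%R -> (forall x, 0 <= h x)%R ->
  \int[P]_w (g (Z w) * h (W w))%:E =
  (\int[P]_w (g (Z w))%:E) * \int[P]_w (h (W w))%:E.
Proof.
move=> mg mh g0 h0.
rewrite (ge0_integral_independent_pair (f := fun p => (g p.1 * h p.2)%:E)); last 2 first.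
- apply/measurable_EFinP; apply: measurable_funM.
    exact: measurableT_comp.
  exact: measurableT_comp.
- by move=> p; rewrite lee_fin mulr_ge0.
have mhW : measurable_fun setT (fun w => (h (W w))%:E).
  by apply/measurable_EFinP; exact: measurableT_comp.
have mgZ : measurable_fun setT (fun w => (g (Z w))%:E).
  by apply/measurable_EFinP; exact: measurableT_comp.
rewrite -ge0_integralZr//; last 2 first.
- by move=> x _; rewrite lee_fin.
- by apply: integral_ge0 => x _; rewrite lee_fin.
apply: eq_integral => x _ /=; under eq_integral do rewrite EFinM.
rewrite ge0_integralZl//; last by rewrite lee_fin.
by move=> y _; rewrite lee_fin.
Qed.

End independent_pair.

(** * Integrals against an exponential law *)

Section exponential_law.
Context {R : realType} (lambda : R) (lambda_gt0 : 0 < lambda)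
  (nu : probability R R).
Hypothesis nuE : forall A : set R, measurable A -> nu A = exponential_prob lambda A.
Local Notation mu := (@lebesgue_measure R).
Implicit Types (u x : R) (k : nat).

Let lambda_ge0 : 0 <= lambda := ltW lambda_gt0.

Let mpdf : measurable_fun setT (fun x => (exponential_pdf lambda x)%:E).
Proof. by apply/measurable_EFinP; exact: measurable_exponential_pdf. Qed.

(* Lebesgue measure lives on a type with the carrier and the Borel sets of R, but
   with a measurable structure of its own; nu is moved there by the identity. *)
Let idR : R -> measurableTypeR R := idfun.
Let midR : measurable_fun setT idR.
Proof. exact: (@measurable_id _ R setT). Qed.
Let idR_mfun : {mfun R >-> measurableTypeR R} :=
  HB.pack idR (isMeasurableFun.Build _ _ _ _ _ midR).
Let nu' : probability (measurableTypeR R) R := distribution nu idR_mfun.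

Let nu'_dominated : nu' `<< mu.
Proof.
apply/null_content_dominatesP => A mA muA0; rewrite [LHS](nuE mA) /exponential_prob.
apply: null_set_integral => //.
exact: measurable_funTS mpdf.
Qed.

(** The exponential density is the Radon-Nikodym derivative of the law. *)
Lemma ge0_integral_exponential_law (f : R -> \bar R) (U : set R) :
  measurable U -> measurable_fun U f -> (forall x, U x -> 0 <= f x)%E ->
  (\int[nu]_(x in U) f x < +oo)%E ->
  (\int[nu]_(x in U) f x =
   \int[mu]_(x in U) (f x * (exponential_pdf lambda x)%:E))%E.
Proof.
move=> mU mf f0 f_lty.
have nu_nu' : (\int[nu]_(x in U) f x = \int[nu']_(x in U) f x)%E.
  by symmetry; apply: (ge0_integral_pushforward midR nu mU mf) => x; rewrite inE => /f0.
have intf : nu'.-integrable U f.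
  apply/integrableP; split; first exact: mf.
  suff -> : (\int[nu']_(x in U) `|f x| = \int[nu']_(x in U) f x)%E.
    by rewrite -nu_nu'.
  by apply: eq_integral => x; rewrite inE => Ux; rewrite gee0_abs// f0.
rewrite nu_nu' -(Radon_Nikodym_change_of_variables nu'_dominated mU intf).
apply: ae_eq_integral => //.
- apply: emeasurable_funM => //; apply: (measurable_int mu).
  apply: (integrableS _ _ (@subsetT _ _)) => //=.
  by apply: Radon_Nikodym_integrable; exact: nu'_dominated.
- by apply: emeasurable_funM => //; apply: measurable_funTS.
- apply: ae_eqe_mul2l => /=.
  rewrite Radon_NikodymE; case: cid => /= h [h1 h2 h3].
  apply: integral_ae_eq => //=.
  + exact: integrableS h2.
  + exact: measurable_funTS.
  + by move=> E E01 mE; rewrite -h3//=; exact: nuE.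
Qed.

Lemma integral_power u k : 0 <= u ->
  (\int[mu]_(x in `[0%R, u]) ((u - x) ^+ k)%:E = (u ^+ k.+1 / k.+1%:R)%:E)%E.
Proof.
rewrite le_eqVlt => /orP[/eqP <-|u0].
  by rewrite set_itv1 integral_set1 exprS !mul0r.
have df x : is_derive x 1 (fun y => - ((u - y) ^+ k.+1 / k.+1%:R)) ((u - x) ^+ k).
  have d1 : is_derive x 1 (fun y => u - y) (-1).
    have := is_deriveB (is_derive_cst u x 1) (is_derive_id x 1).
    by rewrite sub0r.
  have d2 := is_deriveX k.+1 d1; have := is_deriveZ (- k.+1%:R^-1) d2.
  have -> : - k.+1%:R^-1 \*: (fun y => u - y) ^+ k.+1 =
      (fun y => - ((u - y) ^+ k.+1 / k.+1%:R)).
    by apply/funext => y; rewrite /= exprfctE /GRing.scale/= mulNr mulrC.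
  move/is_derive_eq; apply; rewrite /GRing.scale/=.
  by field; rewrite nat1r pnatr_eq0.
have cf x : {for x, continuous (fun y => - ((u - y) ^+ k.+1 / k.+1%:R))}.
  apply: differentiable_continuous; apply/derivable1_diffP.
  by have [] := df x.
rewrite (@continuous_FTC2 _ _ (fun x => - ((u - x) ^+ k.+1 / k.+1%:R)) 0 u)//.
- by rewrite subrr subr0 exprS !mul0r oppr0 sub0e -EFinN opprK.
- apply: continuous_subspaceT => x.
  apply: (@continuous_comp _ _ _ (fun x => u - x) (fun y => y ^+ k)).
    by apply: cvgB; [exact: cvg_cst|exact: cvg_id].
  exact: exprn_continuous.
- split.
  + by move=> x _; have [] := df x.
  + by apply: cvg_at_right_filter; exact: cf.
  + by apply: cvg_at_left_filter; exact: cf.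
- by move=> x _; rewrite derive1E; apply: derive_val.
Qed.

Lemma exponential_law_neg : nu `]-oo, 0[%classic = 0%E.
Proof.
rewrite nuE// /exponential_prob; apply: integral0_eq => x /=.
by rewrite in_itv/= => x0; rewrite lt0_exponential_pdf.
Qed.

Lemma exponential_law_tail u : 0 <= u -> nu `]u, +oo[%classic = (expR (- (lambda * u)))%:E.
Proof.
move=> u0.
have itv0u : nu `[0, u]%classic = (1 - expR (- (lambda * u)))%:E.
  rewrite nuE//; move: u0; rewrite le_eqVlt => /orP[/eqP <-|u0].
    by rewrite /exponential_prob set_itv1 integral_set1 mulr0 oppr0 expR0 subrr.
  by rewrite exponential_prob_itv0c// mulNr.
have Nyu : nu `]-oo, u]%classic = (1 - expR (- (lambda * u)))%:E.
  have -> : `]-oo, u]%classic = `]-oo, 0[%classic `|` `[0, u]%classic.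
    apply/seteqP; split => x /=; rewrite !in_itv/=.
      by case: (leP 0 x) => x0 ->; [right|left].
    by move=> [/ltW /le_trans|/andP[]//]; exact.
  rewrite measureU//; first by rewrite [X in (X + _)%E]exponential_law_neg add0e.
  apply/seteqP; split => x //=; rewrite !in_itv/= => -[x0 /andP[]].
  by rewrite leNgt x0.
rewrite -setCitvl probability_setC// Nyu -EFinB; congr EFin; lra.
Qed.

(** The factor exp (lambda x) cancels the density, and the integral of a power
    remains. *)
Lemma exponential_law_moment u k : 0 <= u ->
  (\int[nu]_(x in `[0%R, u]) (expR (lambda * x) * (u - x) ^+ k)%:E =
   (lambda * (u ^+ k.+1 / k.+1%:R))%:E)%E.
Proof.
move=> u0.
have mf : measurable_fun setT (fun x => (expR (lambda * x) * (u - x) ^+ k)%:E).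
  apply/measurable_EFinP; apply: measurable_funM.
    apply: measurableT_comp => //; exact: measurable_funM.
  apply: measurable_funX; exact: measurable_funB.
have f0 x : `[0, u]%classic x -> (0 <= (expR (lambda * x) * (u - x) ^+ k)%:E)%E.
  rewrite /= in_itv/= => /andP[x0 xu].
  by rewrite lee_fin mulr_ge0 ?expR_ge0 ?exprn_ge0// subr_ge0.
rewrite ge0_integral_exponential_law//; last 2 first.
- exact: measurable_funTS.
- apply: (@le_lt_trans _ _ (\int[nu]_(x in `[0%R, u]) (expR (lambda * u) * u ^+ k)%:E)%E).
    apply: ge0_le_integral => //; first exact: measurable_funTS.
    move=> x /=; rewrite in_itv/= => /andP[x0 xu].
    have ux : 0 <= u - x by rewrite subr_ge0.
    rewrite lee_fin ler_pM ?expR_ge0 ?exprn_ge0//.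
      by rewrite ler_expR ler_wpM2l.
    by rewrite lerXn2r ?nnegrE// gerBl.
  rewrite integral_cst// lte_mul_pinfty ?lee_fin ?mulr_ge0 ?expR_ge0 ?exprn_ge0//.
  by rewrite (le_lt_trans (probability_le1 _ _))// ltry.
rewrite EFinM -integral_power// -ge0_integralZl//.
- apply: eq_integral => x; rewrite inE/= in_itv/= => /andP[x0 _].
  rewrite exponential_pdfE// -!EFinM; congr EFin.
  transitivity (lambda * (u - x) ^+ k * (expR (lambda * x) * expR (- lambda * x))).
    by ring.
  by rewrite -expRD mulNr subrr expR0 mulr1.
- apply/measurable_EFinP; apply: measurable_funTS.
  apply: measurable_funX; exact: measurable_funB.
- move=> x /=; rewrite in_itv/= => /andP[x0 xu].
  by rewrite lee_fin exprn_ge0// subr_ge0.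
Qed.

End exponential_law.

(** * Laplace transform of a compound Poisson sum *)

Section compound_poisson_law.
Context {d : measure_display} {T : measurableType d} {R : realType}
  (P : probability T R) (lambda : R) (tau xi : nat -> {RV P >-> R}).
Hypothesis lambda_gt0 : 0 < lambda.
Let X (k : nat + nat) : {RV P >-> R} :=
  match k with inl i => tau i | inr i => xi i end.
Hypothesis indX : mutually_independent X.
Hypothesis tau_law : forall i (A : set R), measurable A ->
  distribution P (tau i) A = exponential_prob lambda A.
Hypothesis xi_law : forall i (A : set R), measurable A ->
  distribution P (xi i) A = distribution P (xi 0%N) A.

Definition arrival n (w : T) : R := \sum_(i < n) tau i w.
Definition jump_sum n (w : T) : R := \sum_(i < n) xi i w.
Definition count_event (t : R) n : set T :=
  [set w | arrival n w <= t /\ t < arrival n.+1 w].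

Let clocks n : set (nat + nat) := [set k | if k is inl i then (i < n)%N else False].
(* All the clocks are included: the event of a count, which depends on them, has to
   stay on the same side as the first n jumps. *)
Let jumps n : set (nat + nat) :=
  [set k | if k is inr i then (i < n)%N else True].

Lemma measurable_arrival_clocks n :
  measurable_fun setT (arrival n : family_sigma X (clocks n) -> R).
Proof.
apply: measurable_sum => i.
exact: (@measurable_family_member _ _ _ _ _ X (clocks n) (inl (i : nat)) (ltn_ord i)).
Qed.

Lemma measurable_arrival n : measurable_fun setT (arrival n).
Proof. exact: measurable_family_sigma (@measurable_arrival_clocks n). Qed.

Lemma arrival_clock_independent n (A B : set R) :
  measurable A -> measurable B ->
  P (arrival n @^-1` A `&` tau n @^-1` B) =
  (P (arrival n @^-1` A) * P (tau n @^-1` B))%E.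
Proof.
move=> mA mB.
apply: (family_sigma_independent indX (J1 := clocks n) (J2 := [set inl n])).
- by apply/seteqP; split => // -[i|i]/= [] // + [ni]; rewrite ni ltnn.
- by rewrite -[_ @^-1` _]setTI; exact: measurable_arrival_clocks.
- rewrite -[_ @^-1` _]setTI.
  by apply: (@measurable_family_member _ _ _ _ _ X _ (inl n)).
Qed.

Lemma integral_clock n (f : R -> \bar R) : measurable_fun setT f ->
  (forall x, 0 <= f x)%E ->
  (\int[P]_w f (tau n w) = \int[distribution P (tau n)]_(x in `[0%R, +oo[) f x)%E.
Proof.
move=> mf f0; rewrite -(ge0_integral_distribution (tau n) mf f0).
have null : distribution P (tau n) `]-oo, 0[%classic = 0%E.
  exact: exponential_law_neg (tau_law n).
rewrite (ge0_negligible_integral _ _ _ _ null)//.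
by rewrite setTD setCitvl.
Qed.

(** A family of weights which is stable when a clock is integrated out: this
    raises k by one and changes only the constant in front. The weight for k = 0
    yields the probability of a count, by conditioning on the last arrival. *)
Definition arrival_weight (t : R) k x : R :=
  expR (lambda * x) * (t - x) ^+ k * \1_`]-oo, t] x.

Lemma measurable_arrival_weight t k : measurable_fun setT (arrival_weight t k).
Proof.
apply: measurable_funM; last exact: measurable_indic.
apply: measurable_funM.
  apply: measurableT_comp => //; exact: measurable_funM.
apply: measurable_funX; exact: measurable_funB.
Qed.

Lemma arrival_weight_ge0 t k x : 0 <= arrival_weight t k x.
Proof.
rewrite /arrival_weight indicE; case: (boolP (x \in _)); last by rewrite mulr0.
rewrite inE/= in_itv/= mulr1 => xt.
by rewrite mulr_ge0 ?expR_ge0// exprn_ge0// subr_ge0.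
Qed.

(** The factor exp (lambda s) comes out, and what remains on [0, t - s] is the
    moment computed for the exponential law. If t < s both sides vanish. *)
Lemma integral_arrival_weight_clock n t k s :
  (\int[P]_w (arrival_weight t k (s + tau n w))%:E =
   (lambda / k.+1%:R * arrival_weight t k.+1 s)%:E)%E.
Proof.
rewrite (integral_clock n (f := fun x => (arrival_weight t k (s + x))%:E)); last 2 first.
- apply/measurable_EFinP; apply: measurableT_comp => //.
    exact: measurable_arrival_weight.
  exact: measurable_funD.
- by move=> x; rewrite lee_fin arrival_weight_ge0.
have [st|ts] := leP s t; last first.
  rewrite integral0_eq; last first.
    move=> x /=; rewrite in_itv/= andbT => x0.
    rewrite /arrival_weight indicE memNset ?mulr0//= in_itv/=.
    by apply/negP; rewrite -ltNge ltr_wpDr.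
  rewrite /arrival_weight indicE memNset ?mulr0//= in_itv/=.
  by apply/negP; rewrite -ltNge.
transitivity (\int[distribution P (tau n)]_(x in `[0%R, (t - s)%R])
   ((expR (lambda * s))%:E * (expR (lambda * x) * ((t - s) - x) ^+ k)%:E))%E.
  rewrite integral_mkcond [RHS]integral_mkcond; apply: eq_integral => x _.
  rewrite !patchE; have [x0|x0] := boolP (0 <= x); last first.
    by rewrite !memNset//= in_itv/= (negbTE x0).
  rewrite [x \in _]mem_set; last by rewrite /= in_itv/= x0.
  rewrite /arrival_weight indicE.
  have [xt|tx] := leP x (t - s).
    rewrite [x \in _]mem_set; last by rewrite /= in_itv/= x0.
    rewrite mem_set; last by rewrite /= in_itv/= -lerBrDl.
    rewrite -EFinM mulrDr expRD opprD addrA mulr1; congr EFin; ring.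
  rewrite [x \in _]memNset; last first.
    by rewrite /= in_itv/= x0/=; apply/negP; rewrite -ltNge.
  rewrite memNset ?mulr0//=.
  by rewrite in_itv/=; apply/negP; rewrite -ltNge -ltrBlDl.
rewrite ge0_integralZl//.
- rewrite (exponential_law_moment lambda_gt0 (tau_law n)) ?subr_ge0//.
  rewrite /arrival_weight indicE mem_set//= -EFinM; congr EFin.
  by field; rewrite nat1r pnatr_eq0.
- apply/measurable_EFinP; apply: measurable_funTS; apply: measurable_funM.
    apply: measurableT_comp => //; exact: measurable_funM.
  apply: measurable_funX; exact: measurable_funB.
- move=> x /=; rewrite in_itv/= => /andP[x0 xt].
  by rewrite lee_fin mulr_ge0 ?expR_ge0// exprn_ge0// subr_ge0.
Qed.

Lemma integral_arrival_step n (f : R * R -> \bar R) : measurable_fun setT f ->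
  (forall p, 0 <= f p)%E ->
  (\int[P]_w f (arrival n w, tau n w) =
   \int[P]_x \int[P]_y f (arrival n x, tau n y))%E.
Proof.
move=> mf f0; apply: ge0_integral_independent_pair => //.
- exact: measurable_arrival.
- exact: arrival_clock_independent.
Qed.

Lemma arrivalS n w : arrival n.+1 w = arrival n w + tau n w.
Proof. by rewrite /arrival big_ord_recr. Qed.

(** The last clock is integrated out, independently of the arrivals before it; the
    product of the successive constants is k! / (n + k)!, as in the gamma law. *)
Lemma integral_arrival_weight n t k : 0 <= t ->
  (\int[P]_w (arrival_weight t k (arrival n w))%:E =
   (lambda ^+ n * t ^+ (n + k) * k`!%:R / (n + k)`!%:R)%:E)%E.
Proof.
move=> t0; elim: n k => [|n IH] k.
  under eq_integral do rewrite /arrival big_ord0.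
  rewrite integral_cst// [X in (_ * X)%E]probability_setT mule1.
  rewrite /arrival_weight indicE mem_set.
    by rewrite mulr0 expR0 subr0 !mul1r !mulr1 add0n mulfK// pnatr_eq0 -lt0n fact_gt0.
  by rewrite /= in_itv.
under eq_integral do rewrite arrivalS.
rewrite (integral_arrival_step n
    (f := fun p => (arrival_weight t k (p.1 + p.2))%:E)); last 2 first.
- apply/measurable_EFinP; apply: measurableT_comp => //.
    exact: measurable_arrival_weight.
  exact: measurable_funD.
- by move=> p; rewrite lee_fin arrival_weight_ge0.
under eq_integral do rewrite /= integral_arrival_weight_clock EFinM.
rewrite ge0_integralZl//; last 3 first.
- apply/measurable_EFinP; apply: measurableT_comp => //.
    exact: measurable_arrival_weight.
  exact: measurable_arrival.
- by move=> x _; rewrite lee_fin arrival_weight_ge0.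
- by rewrite lee_fin divr_ge0// ltW.
rewrite IH -EFinM addnS addSn; congr EFin.
rewrite !exprS (factS k) natrM; field.
by rewrite !pnatr_eq0 nat1r -!lt0n fact_gt0 pnatr_eq0.
Qed.

Lemma probabilityE (A : set T) : measurable A ->
  P A = (\int[P]_w (\1_A w)%:E)%E.
Proof. by move=> mA; rewrite integral_indic// setIT. Qed.

Lemma count_eventE t n w : (\1_(count_event t n) w : R) =
  \1_`]-oo, t] (arrival n w) * \1_`]t, +oo[ (arrival n w + tau n w).
Proof.
rewrite !indicE -natrM mulnb; congr (nat_of_bool _)%:R.
apply/idP/andP; rewrite !inE/= !in_itv/= andbT /count_event/= arrivalS.
  by case.
by case.
Qed.

Lemma measurable_count_event_clocks t n :
  <<s cylinders X (clocks n.+1) >> (count_event t n).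
Proof.
have -> : count_event t n = (arrival n @^-1` `]-oo, t] `&` arrival n.+1 @^-1` `]t, +oo[).
  by apply/seteqP; split => w /=; rewrite !in_itv/= andbT.
apply: (@measurableI _ (family_sigma X (clocks n.+1))).
  rewrite -[X in measurable X]setTI; apply: measurable_sum => // i.
  exact: (@measurable_family_member _ _ _ _ _ X (clocks n.+1) (inl (i : nat))
    (ltnW (ltn_ord i))).
by rewrite -[X in measurable X]setTI; exact: measurable_arrival_clocks.
Qed.

Lemma measurable_count_event t n : measurable (count_event t n).
Proof. exact: family_sigma_measurable (@measurable_count_event_clocks t n). Qed.

Lemma clock_tail n u : 0 <= u -> P (tau n @^-1` `]u, +oo[) = (expR (- (lambda * u)))%:E.
Proof.
by move=> u0; rewrite -(exponential_law_tail (tau_law n) u0).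
Qed.

(** If the n-th arrival occurs at s <= t, the next clock has to exceed t - s, with
    probability exp (- lambda t) exp (lambda s): the weight for k = 0. *)
Lemma count_event_probability t n : 0 <= t ->
  P (count_event t n) = (expR (- (lambda * t)) * ((lambda * t) ^+ n / n`!%:R))%:E.
Proof.
move=> t0.
rewrite probabilityE; last exact: measurable_count_event.
under eq_integral do rewrite count_eventE.
have mleft : measurable_fun setT (\1_(`]-oo, t] : set R) : R -> R) by exact: measurable_indic.
have mright : measurable_fun setT (\1_(`]t, +oo[ : set R) : R -> R) by exact: measurable_indic.
rewrite (integral_arrival_step n (f := fun p =>
   (\1_`]-oo, t] p.1 * \1_`]t, +oo[ (p.1 + p.2))%:E)); last 2 first.
- apply/measurable_EFinP; apply: measurable_funM; apply: measurableT_comp => //.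
  exact: measurable_funD.
- by move=> p; rewrite lee_fin mulr_ge0.
transitivity (\int[P]_x ((expR (- (lambda * t)))%:E * (arrival_weight t 0 (arrival n x))%:E))%E.
  apply: eq_integral => x _ /=; set s := arrival n x.
  rewrite /arrival_weight indicE.
  have [st|ts] := leP s t; last first.
    rewrite memNset; last by rewrite /= in_itv/=; apply/negP; rewrite -ltNge.
    by under eq_integral do rewrite mul0r; rewrite integral0 !mulr0 mule0.
  rewrite mem_set; last by rewrite /= in_itv.
  under eq_integral do rewrite mul1r.
  transitivity (P (tau n @^-1` `]t - s, +oo[)).
    rewrite probabilityE; last first.
      by rewrite -[X in measurable X]setTI; exact: measurable_funP.
    apply: eq_integral => y _; rewrite !indicE; congr (nat_of_bool _)%:R%:E.
    by apply/idP/idP; rewrite !inE/= !in_itv/= !andbT ltrBlDl.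
  rewrite clock_tail ?subr_ge0// expr0 !mulr1 -EFinM -expRD.
  by congr (expR _)%:E; ring.
rewrite ge0_integralZl//; last 2 first.
- apply/measurable_EFinP; apply: measurableT_comp => //.
    exact: measurable_arrival_weight.
  exact: measurable_arrival.
- by move=> x _; rewrite lee_fin arrival_weight_ge0.
rewrite integral_arrival_weight// addn0 fact0 mulr1 exprMn -EFinM.
by congr EFin; rewrite mulrA.
Qed.

Lemma clock_ge0_ae : {ae P, forall w, forall n, 0 <= tau n w}.
Proof.
have : P.-negligible (\bigcup_n (tau n @^-1` `]-oo, 0[)).
  apply: negligible_bigcup => n; exists (tau n @^-1` `]-oo, 0[); split => //.
    by rewrite -[X in measurable X]setTI; exact: measurable_funP.
  exact: (exponential_law_neg (nu := distribution P (tau n)) (tau_law n)).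
apply: negligibleS => w /= /existsNP[n tau_n]; exists n => //=.
by rewrite in_itv/= ltNge; apply/negP.
Qed.

Lemma measurable_jump_sum n : measurable_fun setT (jump_sum n).
Proof. by apply: measurable_sum => i; exact: measurable_funP. Qed.

(** The event E depends on the clocks. The jumps are integrated out one by one: what
    precedes the last jump is a function of the clocks and the earlier jumps,
    hence independent of it. *)
Lemma integral_jump_sum z phi n E :
  (\int[P]_w (expR (- z * xi 0%N w))%:E = phi%:E)%E ->
  <<s cylinders X (jumps 0) >> E ->
  (\int[P]_w (\1_E w * expR (- z * jump_sum n w))%:E = P E * (phi ^+ n)%:E)%E.
Proof.
move=> phiE sE.
have mE : measurable E by exact: family_sigma_measurable sE.
elim: n => [|n IH].
  under eq_integral do rewrite /jump_sum big_ord0 mulr0 expR0 mulr1.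
  by rewrite integral_indic// setIT expr0 mule1.
pose Z w := \1_E w * expR (- z * jump_sum n w).
have Z0 w : 0 <= Z w by rewrite mulr_ge0 ?expR_ge0.
have mexp : measurable_fun setT (fun x => expR (- z * x)).
  by apply: measurableT_comp => //; exact: measurable_funM.
have mZs : measurable_fun setT (Z : family_sigma X (jumps n) -> R).
  apply: measurable_funM.
    apply: measurable_indic.
    move: E sE {mE IH Z Z0}; apply: smallest_sub.
      exact: (@sigma_algebra_measurable _ (family_sigma X (jumps n))).
    move=> _ [s [A [us sJ mA ->]]]; apply: sub_sigma_algebra.
    exists s, A; split => // i /sJ.
    by rewrite !inE ?asboolE; case: i => [i|i] //; rewrite /jumps/= ltn0.
  have mjump : measurable_fun setT (jump_sum n : family_sigma X (jumps n) -> R).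
    apply: measurable_sum => i.
    exact: (@measurable_family_member _ _ _ _ _ X (jumps n) (inr (i : nat))
      (ltn_ord i)).
  exact (measurableT_comp mexp mjump).
have mZ : measurable_fun setT Z := measurable_family_sigma mZs.
have ind (A B : set R) : measurable A -> measurable B ->
    P (Z @^-1` A `&` xi n @^-1` B) = (P (Z @^-1` A) * P (xi n @^-1` B))%E.
  move=> mA mB.
  apply: (family_sigma_independent indX (J1 := jumps n) (J2 := [set inr n])).
  - by apply/seteqP; split => // -[i|i]/= [] // + [ni]; rewrite ni ltnn.
  - by rewrite -[_ @^-1` _]setTI; exact: mZs.
  - rewrite -[_ @^-1` _]setTI.
    by apply: (@measurable_family_member _ _ _ _ _ X _ (inr n)).
(* The absolute value is there to have a function that is nonnegative on R, not
   only on the values of Z. *)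
transitivity (\int[P]_w (`|Z w| * expR (- z * xi n w))%:E)%E.
  apply: eq_integral => w _; rewrite ger0_norm// /Z /jump_sum big_ord_recr/=.
  by rewrite mulrDr expRD mulrA.
rewrite (ge0_integral_independentM mZ _ ind (g := fun x => `|x|)
   (h := fun x => expR (- z * x)))//.
under eq_integral do rewrite ger0_norm//.
rewrite IH exprSr EFinM muleA; congr (_ * _)%E.
have mexpE : measurable_fun setT (fun x => (expR (- z * x))%:E) by exact/measurable_EFinP.
have exp0 x : (0 <= (expR (- z * x))%:E)%E by rewrite lee_fin expR_ge0.
rewrite -phiE -(ge0_integral_distribution (xi n) mexpE)//.
rewrite -(ge0_integral_distribution (xi 0%N) mexpE)//.
by apply: eq_measure_integral => A mA _; exact: xi_law.
Qed.

Lemma count_event_unique t n m w : (forall i, 0 <= tau i w) ->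
  count_event t n w -> count_event t m w -> n = m.
Proof.
move=> tau0.
have arrival_le i j : (i <= j)%N -> arrival i w <= arrival j w.
  move=> /subnK <-; elim: (j - i)%N => // k /le_trans; apply.
  by rewrite addSn arrivalS lerDl.
move=> [n1 n2] [m1 m2]; have [nm|mn|//] := ltngtP n m.
  by have := le_lt_trans (arrival_le _ _ nm) (le_lt_trans m1 n2); rewrite ltxx.
by have := le_lt_trans (arrival_le _ _ mn) (le_lt_trans n1 m2); rewrite ltxx.
Qed.

(** The transform is split according to the number n of arrivals. As the clocks and
    the jumps are independent, the n-th term is the Poisson probability of n times
    phi ^ n, and these sum to an exponential. *)
Lemma compound_poisson_transform (y : T -> R) t z phi :
  0 <= t -> measurable_fun setT y ->
  {ae P, forall w, exists2 n, count_event t n w & y w = jump_sum n w} ->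
  (\int[P]_w (expR (- z * xi 0%N w))%:E = phi%:E)%E ->
  (\int[P]_w (expR (- z * y w))%:E = (expR (- (t * (lambda * (1 - phi)))))%:E)%E.
Proof.
move=> t0 my yE phiE.
have phi0 : 0 <= phi.
  by rewrite -lee_fin -phiE; apply: integral_ge0 => w _; rewrite lee_fin expR_ge0.
pose term n w : \bar R := (\1_(count_event t n) w * expR (- z * jump_sum n w))%:E.
have term0 n w : (0 <= term n w)%E by rewrite lee_fin mulr_ge0 ?expR_ge0.
have mterm n : measurable_fun setT (term n).
  apply/measurable_EFinP; apply: measurable_funM.
    by apply: measurable_indic; exact: measurable_count_event.
  apply: measurableT_comp => //; apply: measurable_funM => //.
  exact: measurable_jump_sum.
transitivity (\int[P]_w (\sum_(n <oo) term n w))%E.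
  apply: ge0_ae_eq_integral => //.
  - apply/measurable_EFinP; apply: measurableT_comp => //.
    exact: measurable_funM.
  - by apply: ge0_emeasurable_sum.
  - by move=> w _; apply: nneseries_ge0.
  - apply: filterS2 clock_ge0_ae yE => w tau0 [n nw ->] _.
    rewrite (@nneseriesD1 R (term^~ w) n xpredT)// eseries0 ?adde0; last first.
      move=> m _ /= mn; rewrite /term indicE memNset ?mul0r// => mw.
      by move: mn; rewrite (count_event_unique tau0 mw nw) eqxx.
    by rewrite /term indicE mem_set// mul1r.
rewrite integral_nneseries//.
transitivity (\sum_(n <oo) ((expR (- (lambda * t)))%:E *
    ((lambda * t * phi) ^+ n / n`!%:R)%:E))%E.
  apply: eq_eseriesr => n _; rewrite (integral_jump_sum _ phiE); last first.
    move: (@measurable_count_event_clocks t n); apply: smallest_sub.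
      exact: (@sigma_algebra_measurable _ (family_sigma X (jumps 0))).
    move=> _ [s [A [us sJ mA ->]]]; apply: sub_sigma_algebra.
    exists s, A; split => // i /sJ.
    by rewrite !inE ?asboolE; case: i => [i|i].
  rewrite count_event_probability// -!EFinM; congr EFin.
  by rewrite [in RHS]exprMn; ring.
have lt0 : 0 <= lambda * t by rewrite mulr_ge0// ltW.
rewrite nneseriesZl; last first.
  by move=> n _; rewrite lee_fin divr_ge0// exprn_ge0// mulr_ge0.
rewrite (nneseries_expR (mulr_ge0 lt0 phi0)) -EFinM -expRD.
by congr (expR _)%:E; ring.
Qed.

End compound_poisson_law.

(** * Quantile functions *)

Section rays.
Context {R : realType}.

Lemma measurable_fun_rays {d} {T : measurableType d} (f : T -> R) :
  (forall x, measurable [set w | x < f w]) -> measurable_fun setT f.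
Proof.
move=> mf; apply: (measurability _ (RGenOInfty.measurableE R)).
move=> _ [_ [x ->] <-]; rewrite setTI.
have -> : f @^-1` `]x, +oo[ = [set w | x < f w].
  by apply/seteqP; split => w /=; rewrite in_itv/= andbT.
exact: mf.
Qed.

(** The rays are stable under intersection and generate the Borel sets. *)
Lemma measure_eq_rays (m1 m2 : {measure set R -> \bar R}) :
  (forall x, m1 `]x, +oo[%classic < +oo)%E ->
  (forall x, m1 `]x, +oo[%classic = m2 `]x, +oo[%classic) ->
  forall A, measurable A -> m1 A = m2 A.
Proof.
move=> m1fin m12 A mA.
apply: (@measure_unique _ _ R [set A | exists x, A = `]x, +oo[%classic]
  (fun n => `](- n%:R : R), +oo[%classic) _ _ _ _ m1 m2 _ _ A mA) => //.
- exact: RGenOInfty.measurableE.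
- move=> _ _ [x ->] [y ->]; exists (Num.max x y).
  by apply/seteqP; split => z /=; rewrite !in_itv/= !andbT gt_max; [move=> [-> ->]|move/andP].
- by move=> n; exists (- n%:R).
- apply/seteqP; split => // x _; exists (Num.truncn (- x)).+1 => //=.
  by rewrite in_itv/= andbT ltrNl truncnS_gt.
- by move=> _ [x ->]; exact: m12.
Qed.

End rays.

Lemma measure_setD_null {d} {T : measurableType d} {R : realType}
    (mu : {measure set T -> \bar R}) (N B : set T) :
  measurable N -> mu N = 0%E -> measurable B -> mu B = mu (B `\` N).
Proof.
move=> mN N0 mB; rewrite -(measureU0 (A := B `\` N) (B := B `&` N)).
- by rewrite setUC setUIDK.
- exact: measurableD.
- exact: measurableI.
- by apply: (subset_measure0 _ _ _ N0) => //; exact: measurableI.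
Qed.

Section quantile.
Context {R : realType} (nu : probability R R).

Let id_mfun : {RV nu >-> R} :=
  HB.pack (idfun : R -> R) (isMeasurableFun.Build _ _ _ _ _ (@measurable_id _ R setT)).
Let F (x : R) : R := fine (cdf id_mfun x).
Let cdfE x : cdf id_mfun x = (F x)%:E.
Proof. by rewrite fineK// /cdf fin_num_measure. Qed.
Let FE x : nu `]-oo, x]%classic = (F x)%:E.
Proof. by rewrite -cdfE. Qed.
Let F_ge0 x : 0 <= F x.
Proof. by rewrite -lee_fin -FE measure_ge0. Qed.
Let F_le1 x : F x <= 1.
Proof. by rewrite -lee_fin -FE probability_le1. Qed.
Let F_nd x y : x <= y -> F x <= F y.
Proof. by move=> xy; rewrite -lee_fin -!cdfE; exact: cdf_nondecreasing. Qed.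
Let F_right x v : F x < v -> exists2 y, x < y & F y < v.
Proof.
move=> Fxv.
have cF : F y @[y --> x^'+] --> F x.
  by apply: fine_cvg; rewrite -cdfE; exact: cdf_right_continuous.
have xy : \forall y \near x^'+, x < y by exact: nbhs_right_gt.
have [y []] := filter_ex (filterI xy (cvgr_lt _ cF _ Fxv)).
by exists y.
Qed.
Let F_left v : 0 < v -> exists y, F y < v.
Proof.
move=> v0.
have cF : F y @[y --> -oo] --> (0:R).
  apply: fine_cvg; exact: cvg_cdfNy0.
have [y Fy] := filter_ex (cvgr_lt _ cF _ v0).
by exists y.
Qed.
Let F_upper v : v < 1 -> exists y, v < F y.
Proof.
move=> v1.
have cF : F y @[y --> +oo] --> (1:R).
  apply: fine_cvg; exact: cvg_cdfy1.
have [y Fy] := filter_ex (cvgr_gt _ cF _ v1).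
by exists y.
Qed.

(** The generalized inverse of the distribution function. Outside of ]0, 1[ the set
    may be empty or unbounded; these points form a null set for a uniform
    variable. *)
Definition quantile (v : R) : R :=
  if (0 < v) && (v < 1) then sup [set x | F x < v] else 0.

(** Inversion in terms of rays: the inequality is strict on both sides thanks to the
    right continuity of the distribution function. *)
Lemma lt_quantile x v : 0 < v -> v < 1 -> (x < quantile v) = (F x < v).
Proof.
move=> v0 v1; rewrite /quantile v0 v1/=.
have hs : has_sup [set x | F x < v].
  split; first exact: F_left.
  have [M vM] := F_upper v1; exists M => y /= Fyv; rewrite leNgt; apply/negP => My.
  by have := lt_trans Fyv (lt_le_trans vM (F_nd (ltW My))); rewrite ltxx.
apply/idP/idP => [xs|Fx].
  have [y /= Fy xy] := sup_gt hs.1 xs.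
  by apply: le_lt_trans Fy; apply: F_nd; exact: ltW.
have [y xy Fy] := F_right Fx; apply: (lt_le_trans xy).
exact: ub_le_sup hs.2 _ Fy.
Qed.

Lemma measurable_quantile : measurable_fun setT quantile.
Proof.
apply: measurable_fun_rays => x.
have -> : [set v | x < quantile v] = (`]0, 1[ `&` `]F x, +oo[) `|`
    (~` `]0, 1[ `&` [set v | x < 0]).
  apply/seteqP; split => v /=; rewrite !in_itv/= andbT; last first.
    move=> [[/andP[v0 v1] Fx]|[/negP v01 x0]]; first by rewrite lt_quantile.
    by rewrite /quantile (negbTE v01).
  have [/andP[v0 v1]|v01] := boolP ((0 < v) && (v < 1)).
    by rewrite lt_quantile// => Fx; left.
  by rewrite /quantile (negbTE v01) => x0; right; split => //; apply/negP.
apply: measurableU; first exact: measurableI.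
apply: measurableI; first exact: measurableC.
by have [x0|x0] := boolP (x < 0); [rewrite [X in measurable X](_ : _ = setT)|
  rewrite [X in measurable X](_ : _ = set0)] => //; apply/seteqP; split => // y /=.
Qed.

(** By inversion, the quantile exceeds x exactly when the uniform variable exceeds
    F x, which has probability 1 - F x; laws are determined by such rays. *)
Lemma quantile_law {d} {T : measurableType d} (P : probability T R) (V : T -> R) :
  measurable_fun setT V ->
  (forall x, 0 <= x -> x <= 1 -> P (V @^-1` `]x, +oo[) = (1 - x)%:E) ->
  forall A, measurable A -> P ((quantile \o V) @^-1` A) = nu A.
Proof.
move=> mV Vlaw A mA.
have mqV : measurable_fun setT (quantile \o V).
  by apply: measurableT_comp => //; exact: measurable_quantile.
have mVB B : measurable B -> measurable (V @^-1` B).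
  by move=> mB; rewrite -[_ @^-1` _]setTI; exact: mV.
pose q : {RV P >-> R} := HB.pack (quantile \o V) (isMeasurableFun.Build _ _ _ _ _ mqV).
apply: (measure_eq_rays (m1 := distribution P q)) => // [x|x].
  by rewrite (le_lt_trans (probability_le1 _ _))// ltry.
have V01 : P (~` (V @^-1` `]0, 1[)) = 0%E.
  rewrite probability_setC; last exact: mVB.
  have -> : V @^-1` `]0, 1[ = (V @^-1` `]0, +oo[) `\`
      \bigcap_n (V @^-1` `]1 - n.+1%:R^-1, +oo[).
    apply/seteqP; split => w /=; rewrite !in_itv/= ?andbT.
      move=> /andP[v0 v1]; split => //; have [n] := ltr_add_invr v1.
      by move=> h /(_ n I) /=; rewrite in_itv/= andbT ltrBlDr ltNge (ltW h).
    move=> [-> h] /=; rewrite ltNge; apply/negP => v1; apply: h => n _ /=.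
    by rewrite in_itv/= andbT (lt_le_trans _ v1)// gtrBl invr_gt0.
  set A0 := V @^-1` _; set B0 := \bigcap_n _.
  have mB0 : measurable B0 by apply: bigcapT_measurable => n; exact: mVB.
  have PD : P (A0 `\` B0) = (P A0 - P (A0 `&` B0))%E.
    apply: measureD => //; first exact: mVB.
    by rewrite (le_lt_trans (probability_le1 _ _))// ?ltry//; exact: mVB.
  rewrite PD /A0 Vlaw// subr0.
  suff -> : P (V @^-1` `]0, +oo[ `&` B0) = 0%E by rewrite sube0 subee.
  apply/eqP; rewrite eq_le measure_ge0 andbT.
  apply: (cvge_to_ge (@cvge_harmonic R)); apply: nearW => n /=.
  have -> : (n.+1%:R^-1)%:E = P (V @^-1` `]1 - n.+1%:R^-1, +oo[).
    rewrite Vlaw; first by congr EFin; ring.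
    - by rewrite subr_ge0 invf_le1// ler1n.
    - by rewrite gerBl invr_ge0.
  apply: le_measure; rewrite ?inE.
  - by apply: measurableI => //; exact: mVB.
  - exact: mVB.
  - by move=> w [_ /(_ n I)].
have tail : nu `]x, +oo[%classic = (1 - F x)%:E.
  by rewrite -setCitvl probability_setC// FE.
rewrite [RHS]tail -(Vlaw (F x) (F_ge0 x) (F_le1 x)).
have mN : measurable (~` (V @^-1` `]0, 1[)) by apply: measurableC; exact: mVB.
rewrite /distribution /pushforward [LHS](measure_setD_null mN V01); last first.
  rewrite -[X in measurable X]setTI.
  exact: (mqV measurableT _ (measurable_itv `]x, +oo[)).
rewrite [RHS](measure_setD_null mN V01); last exact: mVB.
congr (P _); apply/seteqP; split => w /= [h wN]; split => //;
  move: (wN) h => /contrapT; rewrite /= !in_itv/= !andbT => /andP[v0 v1];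
  by rewrite lt_quantile.
Qed.

End quantile.

(** * Binary digits of a uniform point *)

Section binary_digits.
Context {R : realType} (P : probability R R).
Hypothesis uniformP : forall x : R, 0 <= x -> x <= 1 ->
  P `]x, +oo[%classic = (1 - x)%:E.
Implicit Types (x v : R) (iota : nat -> nat).

Let tail_le0 x : x <= 0 -> P `]x, +oo[%classic = 1%E.
Proof.
move=> x0; apply/eqP; rewrite eq_le probability_le1//=.
rewrite -[leLHS](_ : P `]0, +oo[%classic = _); last by rewrite uniformP// subr0.
apply: le_measure; rewrite ?inE// => y /=; rewrite !in_itv/= !andbT.
exact: le_lt_trans.
Qed.

Let tail_ge1 x : 1 <= x -> P `]x, +oo[%classic = 0%E.
Proof.
move=> x1; apply/eqP; rewrite eq_le measure_ge0 andbT.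
rewrite -[leRHS](_ : P `]1, +oo[%classic = _); last by rewrite uniformP// subrr.
apply: le_measure; rewrite ?inE// => y /=; rewrite !in_itv/= !andbT.
exact: le_lt_trans.
Qed.

(** The first binary digit, for the expansion of points of ]0, 1] which is not
    eventually 0; the doubling map removes it, and sends ]0, 1] to itself. *)
Definition half_bit v : R := \1_`]2^-1, +oo[ v.
Definition doubling v : R := 2 * v - half_bit v.
Definition bit k v : R := half_bit (iter k doubling v).

Lemma measurable_half_bit : measurable_fun setT half_bit.
Proof. exact: measurable_indic. Qed.

Lemma measurable_doubling : measurable_fun setT doubling.
Proof.
apply: measurable_funB; last exact: measurable_half_bit.
exact: measurable_funM.
Qed.

Lemma measurable_bit k : measurable_fun setT (bit k).
Proof.
apply: (measurableT_comp measurable_half_bit).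
elim: k => [|k IH] /=; first exact: measurable_id.
exact: (measurableT_comp measurable_doubling IH).
Qed.

Let mdoubling (B : set R) : measurable B -> measurable (doubling @^-1` B).
Proof. by move=> mB; rewrite -[X in measurable X]setTI; exact: measurable_doubling. Qed.

(* It suffices to compare the two finite measures on rays. *)
Let half_split (H : set R) (mH : measurable H) :
  (forall x, P (H `&` doubling @^-1` `]x, +oo[) = (2^-1)%:E * P `]x, +oo[%classic)%E ->
  forall B, measurable B -> P (H `&` doubling @^-1` B) = ((2^-1)%:E * P B)%E.
Proof.
move=> HE B mB.
have half_ge0 : 0 <= 2^-1 :> R by rewrite invr_ge0.
pose m1 := pushforward (mrestr P mH) (doubling : R -> R).
have m1E A : m1 A = P (H `&` doubling @^-1` A) by rewrite /m1 /pushforward /mrestr setIC.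
have m2E A : mscale (NngNum half_ge0) P A = ((2^-1)%:E * P A)%E by [].
rewrite -m1E -m2E.
pose D : {mfun R >-> R} := HB.pack doubling (isMeasurableFun.Build _ _ _ _ _ measurable_doubling).
apply: (@measure_eq_rays R (pushforward (mrestr P mH) D) (mscale (NngNum half_ge0) P)) => // x.
  apply: (@le_lt_trans _ _ 1%E); last exact: ltry.
  rewrite /pushforward /mrestr; apply: probability_le1.
  by apply: measurableI => //; exact: mdoubling.
by rewrite [LHS]m1E HE.
Qed.

Lemma upper_half_split (B : set R) : measurable B ->
  P (`]2^-1, +oo[ `&` doubling @^-1` B) = ((2^-1)%:E * P B)%E.
Proof.
move: B; apply: half_split => // x.
have -> : `]2^-1, +oo[ `&` doubling @^-1` `]x, +oo[ =
    `](Num.max 2^-1 ((x + 1) / 2)), +oo[%classic.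
  apply/seteqP; split => v /=; rewrite !in_itv/= !andbT gt_max /doubling /half_bit indicE.
    by move=> [v2]; rewrite mem_set/= ?in_itv/= ?v2//= => xv; lra.
  move=> /andP[v2 xv]; split => //; rewrite mem_set/= ?in_itv/= ?v2//=; lra.
have [x0|x0] := leP x 0.
  have -> : Num.max 2^-1 ((x + 1) / 2) = 2^-1 by apply/max_idPl; lra.
  rewrite tail_le0// mule1 uniformP; [|lra..].
  by congr EFin; lra.
have -> : Num.max 2^-1 ((x + 1) / 2) = (x + 1) / 2 by apply/max_idPr; lra.
have [x1|x1] := leP x 1; last by rewrite !tail_ge1 ?mule0//; lra.
rewrite !uniformP; [|lra..].
by rewrite -EFinM; congr EFin; lra.
Qed.

Lemma lower_half_split (B : set R) : measurable B ->
  P (`]-oo, 2^-1] `&` doubling @^-1` B) = ((2^-1)%:E * P B)%E.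
Proof.
move: B; apply: half_split => // x.
have -> : `]-oo, 2^-1] `&` doubling @^-1` `]x, +oo[ =
    (`](x / 2), +oo[ : set R) `\` (`]2^-1, +oo[ : set R).
  apply/seteqP; split => v /=; rewrite !in_itv/= !andbT /doubling /half_bit indicE.
    move=> [v2]; rewrite memNset/= ?in_itv/= ?andbT ?subr0 => [xv|].
      by split; [lra|apply/negP; rewrite -leNgt].
    by apply/negP; rewrite -leNgt.
  move=> [xv /negP]; rewrite -leNgt => v2; split => //.
  rewrite memNset/= ?in_itv/= ?andbT ?subr0; first lra.
  by apply/negP; rewrite -leNgt.
have [x1|x1] := leP x 1; last first.
  rewrite tail_ge1 ?mule0; last lra.
  apply/eqP; rewrite eq_le measure_ge0 andbT.
  rewrite -[leRHS](measure0 P); apply: le_measure; rewrite ?inE//.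
    exact: measurableD.
  move=> v /=; rewrite !in_itv/= !andbT => -[xv /negP]; rewrite -leNgt => v2; lra.
have PD : P (`](x / 2)%R, +oo[%classic `\` `]2^-1%R, +oo[%classic) =
    (P `](x / 2)%R, +oo[%classic - P (`](x / 2)%R, +oo[%classic `&` `]2^-1%R, +oo[%classic))%E.
  apply: measureD => //.
  by rewrite (le_lt_trans (probability_le1 _ _))// ltry.
rewrite PD setIidr; last first.
  move=> v /=; rewrite !in_itv/= !andbT; lra.
rewrite [X in (_ - X)%E]uniformP; [|lra..].
have [x0|x0] := leP x 0.
  rewrite !tail_le0 ?mule1; [|lra..].
  by rewrite -EFinB; congr EFin; lra.
rewrite !uniformP; [|lra..].
by rewrite -EFinB -EFinM; congr EFin; lra.
Qed.

(** On each half of ]0, 1] the doubling map is affine of slope 2 onto ]0, 1]. Hence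
    the doubled point is again uniform, and independent of the digit that tells
    which half the point was in. *)
Lemma half_bit_split (A B : set R) : measurable A -> measurable B ->
  P (half_bit @^-1` A `&` doubling @^-1` B) = (P (half_bit @^-1` A) * P B)%E.
Proof.
move=> mA mB.
pose H1 : set R := `]2^-1, +oo[%classic; pose H0 : set R := `]-oo, 2^-1]%classic.
pose E := half_bit @^-1` A.
have mE : measurable E by rewrite -[E]setTI; exact: measurable_half_bit.
have mH1 : measurable H1 by exact: measurable_itv.
have mH0 : measurable H0 by exact: measurable_itv.
have bit1 v : H1 v -> half_bit v = 1 by move=> h; rewrite /half_bit indicE mem_set.
have bit0 v : H0 v -> half_bit v = 0.
  rewrite /H0/= in_itv/= => h; rewrite /half_bit indicE memNset//= in_itv/= andbT.
  by apply/negP; rewrite -leNgt.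
have H01 : H1 `|` H0 = setT.
  apply/seteqP; split => // v _; rewrite /H1 /H0/= !in_itv/= andbT.
  by have [] := leP v 2^-1; [right|left].
have H10 : H1 `&` H0 = set0.
  apply/seteqP; split => // v; rewrite /H1 /H0/= !in_itv/= andbT => -[].
  by rewrite ltNge => /negP.
have onH1 C : measurable C ->
    P (E `&` H1 `&` doubling @^-1` C) = ((2^-1)%:E * ((\1_A 1)%:E * P C))%E.
  move=> mC; have [A1|A1] := pselect (A 1).
    rewrite indicE mem_set// mul1e -upper_half_split//; congr (P (_ `&` _)).
    by rewrite setIidr// => v /bit1 v1; rewrite /E/= v1.
  rewrite indicE memNset// mul0e mule0 -(measure0 P); congr (P _).
  by apply/seteqP; split => // v [[Ev /bit1 v1] _]; apply: A1; rewrite -v1.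
have onH0 C : measurable C ->
    P (E `&` H0 `&` doubling @^-1` C) = ((2^-1)%:E * ((\1_A 0)%:E * P C))%E.
  move=> mC; have [A1|A1] := pselect (A 0).
    rewrite indicE mem_set// mul1e -lower_half_split//; congr (P (_ `&` _)).
    by rewrite setIidr// => v /bit0 v1; rewrite /E/= v1.
  rewrite indicE memNset// mul0e mule0 -(measure0 P); congr (P _).
  by apply/seteqP; split => // v [[Ev /bit0 v1] _]; apply: A1; rewrite -v1.
have onE C : measurable C -> P (E `&` doubling @^-1` C) =
    ((2^-1)%:E * ((\1_A 1)%:E * P C) + (2^-1)%:E * ((\1_A 0)%:E * P C))%E.
  move=> mC; rewrite -onH1// -onH0//.
  rewrite -{1}[E]setIT -H01 setIUr setIUl measureU//.
  - by apply: measurableI; [exact: measurableI|exact: mdoubling].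
  - by apply: measurableI; [exact: measurableI|exact: mdoubling].
  - by rewrite setIACA -setIIr H10 setI0 set0I.
have PE : P E = ((2^-1)%:E * (\1_A 1)%:E + (2^-1)%:E * (\1_A 0)%:E)%E.
  have := onE setT measurableT; rewrite preimage_setT setIT => ->.
  by rewrite !probability_setT !mule1.
rewrite -/E onE// PE ge0_muleDl ?mule_ge0 ?lee_fin ?invr_ge0//.
by rewrite !muleA.
Qed.

Lemma doubling_invariant (B : set R) : measurable B ->
  P (doubling @^-1` B) = P B.
Proof.
move=> mB; have := @half_bit_split setT B measurableT mB.
by rewrite preimage_setT setTI => ->; rewrite probability_setT mul1e.
Qed.

Lemma bit_law k (A : set R) : measurable A -> P (bit k @^-1` A) = P (bit 0 @^-1` A).
Proof.
move=> mA; elim: k => // k <-; rewrite -[RHS]doubling_invariant.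
  by congr (P _); apply/seteqP; split => v; rewrite /bit/= -iterSr.
by rewrite -[X in measurable X]setTI; exact: measurable_bit.
Qed.

(** The first digit is independent of the doubled point, and the digits of the
    latter are the next digits. *)
Lemma initial_bits_independent n (A : nat -> set R) : (forall k, measurable (A k)) ->
  P (\bigcap_(k in [set k | (k < n)%N]) bit k @^-1` A k) =
  (\prod_(k < n) P (bit k @^-1` A k))%E.
Proof.
elim: n A => [|n IH] A mA.
  rewrite big_ord0 -(probability_setT P); congr (P _).
  by apply/seteqP; split => // v _ k.
rewrite big_ord_recl.
pose C := \bigcap_(k in [set k | (k < n)%N]) bit k @^-1` A k.+1.
have mC : measurable C.
  apply: bigcap_measurableType => k _.
  by rewrite -[X in measurable X]setTI; exact: measurable_bit.
have -> : \bigcap_(k in [set k | (k < n.+1)%N]) bit k @^-1` A k =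
    half_bit @^-1` A 0%N `&` doubling @^-1` C.
  apply/seteqP; split => v.
    move=> h; split; first exact: (h 0%N).
    move=> k /= kn; have := h k.+1; rewrite /bit/= -iterS iterSr; exact.
  by move=> [h0 h] [//|k] /= kn; have := h k kn; rewrite /bit/= -iterS iterSr.
rewrite half_bit_split// IH//; congr (_ * _)%E.
by apply: eq_bigr => k _; rewrite !(@bit_law k) ?(@bit_law (lift ord0 k)).
Qed.

Definition bit_rv k : {RV P >-> R} :=
  HB.pack (bit k) (isMeasurableFun.Build _ _ _ _ _ (measurable_bit k)).

(** A finite set of digits is completed to an initial segment by trivial events. *)
Lemma bits_independent : mutually_independent bit_rv.
Proof.
move=> s A us mA.
pose n := (\max_(i <- s) i).+1.
have sn i : i \in s -> (i < n)%N.
  by move=> si; rewrite /n ltnS; exact: (leq_bigmax_seq (F := id)).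
pose A' k := if k \in s then A k else setT.
have mA' k : measurable (A' k) by rewrite /A'; case: ifP.
have := initial_bits_independent n mA'.
have -> : \bigcap_(k in [set k | (k < n)%N]) bit k @^-1` A' k =
    \big[setI/setT]_(i <- s) (bit_rv i @^-1` A i).
  rewrite -bigcap_seq_eqType; apply/seteqP; split => v h k /= ks.
    by have := h k (sn _ ks); rewrite /A' ks.
  by rewrite /A'; case: ifPn => // ks'; exact: h.
move=> ->; rewrite -(big_mkord xpredT (fun k => P (bit k @^-1` A' k))).
rewrite (bigID (mem s))/= [X in (_ * X)%E]big1 ?mule1; last first.
  by move=> k /negbTE ks; rewrite /A' ks preimage_setT probability_setT.
rewrite -big_filter; have perm : perm_eq [seq i <- index_iota 0 n | i \in s] s.
  apply: uniq_perm => //; first exact/filter_uniq/iota_uniq.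
  move=> k; rewrite mem_filter mem_index_iota/= andb_idr// => ks.
  exact: sn.
rewrite (perm_big _ perm)/= big_seq [RHS]big_seq; apply: eq_bigr => k ks.
by rewrite /A' ks.
Qed.

End binary_digits.

(** * Uniform variables made of selected digits *)

Section binary_expansion.
Context {R : realType} (P : probability R R).
Hypothesis uniformP : forall x : R, 0 <= x -> x <= 1 ->
  P `]x, +oo[%classic = (1 - x)%:E.
Implicit Types (x v : R) (iota : nat -> nat) (m k : nat).

(** Only the digits at the positions iota k are used: sequences of positions with
    disjoint ranges will give independent numbers. *)
Definition digit_sum iota m v : R :=
  \sum_(k < m) 2^-1 ^+ k.+1 * bit (iota k) v.

Definition binary iota v : R := sup (range (fun m => digit_sum iota m v)).

Lemma bit_ge0 k v : 0 <= bit k v.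
Proof. by rewrite /bit /half_bit indicE. Qed.

Lemma bit_le1 k v : bit k v <= 1.
Proof. by rewrite /bit /half_bit indicE; case: (_ \in _). Qed.

Lemma digit_sumS iota m v :
  digit_sum iota m.+1 v = digit_sum iota m v + 2^-1 ^+ m.+1 * bit (iota m) v.
Proof. by rewrite /digit_sum big_ord_recr. Qed.

Lemma digit_sum_le1 iota m v : digit_sum iota m v <= 1 - 2^-1 ^+ m.
Proof.
elim: m => [|m IH]; first by rewrite /digit_sum big_ord0 expr0 subrr.
rewrite digit_sumS exprS; have := bit_le1 (iota m) v.
have : 0 <= 2^-1 ^+ m :> R by rewrite exprn_ge0// invr_ge0.
by nra.
Qed.

Lemma digit_sum_sup iota v : has_sup (range (fun m => digit_sum iota m v)).
Proof.
split; first by exists (digit_sum iota 0 v), 0%N.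
exists 1 => _ [m _ <-]; apply: (le_trans (digit_sum_le1 iota m v)).
by rewrite gerBl exprn_ge0// invr_ge0.
Qed.

Lemma lt_binary iota x v : x < binary iota v <-> exists m, x < digit_sum iota m v.
Proof.
split=> [xs|[m xm]].
  have [_ [m _ <-] xm] := sup_gt (digit_sum_sup iota v).1 xs.
  by exists m.
by apply: (lt_le_trans xm); apply: (ub_le_sup (digit_sum_sup iota v).2); exists m.
Qed.

Lemma digit_sum_nd iota v : nondecreasing_seq (fun m => digit_sum iota m v).
Proof.
apply/nondecreasing_seqP => m; rewrite digit_sumS lerDl mulr_ge0 ?bit_ge0//.
Qed.

Lemma measurable_digit_sum_family iota m (J : set nat) :
  (forall k, (k < m)%N -> J (iota k)) ->
  measurable_fun setT (digit_sum iota m : family_sigma (bit_rv P) J -> R).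
Proof.
move=> iotaJ; apply: measurable_sum => k.
have mk := @measurable_family_member _ _ _ _ _ (bit_rv P) J (iota k) (iotaJ _ (ltn_ord k)).
exact: (measurable_funM (measurable_cst _) mk).
Qed.

Lemma measurable_digit_sum iota m : measurable_fun setT (digit_sum iota m).
Proof.
by apply: measurable_sum => k; apply: measurable_funM => //; exact: measurable_bit.
Qed.

Lemma measurable_binary_family iota (J : set nat) : (forall k, J (iota k)) ->
  measurable_fun setT (binary iota : family_sigma (bit_rv P) J -> R).
Proof.
move=> iotaJ; apply: measurable_fun_rays => x.
have -> : [set v | x < binary iota v] =
    \bigcup_m (digit_sum iota m @^-1` `]x, +oo[).
  apply/seteqP; split => v /=; first move=> /lt_binary[m xm]; first exists m => //=.
    by rewrite in_itv/= andbT.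
  by move=> [m _] /=; rewrite in_itv/= andbT => xm; apply/lt_binary; exists m.
apply: bigcup_measurable => m _; rewrite -[X in measurable X]setTI.
by apply: measurable_digit_sum_family => // k _; exact: iotaJ.
Qed.

Lemma measurable_binary iota : measurable_fun setT (binary iota).
Proof.
apply: (@measurable_family_sigma _ _ _ _ _ (bit_rv P) setT).
exact: measurable_binary_family.
Qed.

(** By induction on m, the law does not depend on the positions: the next digit is
    independent of the sum before it, and all digits have the same law. *)
Lemma digit_sum_law iota m (A : set R) : injective iota -> measurable A ->
  P (digit_sum iota m @^-1` A) = P (digit_sum id m @^-1` A).
Proof.
move=> inj; elim: m A => [|m IH] A mA.
  by congr (P _); apply/seteqP; split => v /=; rewrite /digit_sum !big_ord0.
pose f (p : R * R) : \bar R := (\1_A (p.1 + 2^-1 ^+ m.+1 * p.2))%:E.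
have mf : measurable_fun setT f.
  apply/measurable_EFinP; apply: measurableT_comp => //.
  by apply: measurable_funD => //; apply: measurable_funM.
have f0 p : (0 <= f p)%E by rewrite lee_fin.
pose g s := (\int[P]_y f (s, bit 0 y))%E.
have mg : measurable_fun setT g.
  pose h p := f (p.1, bit 0 p.2).
  have mh : measurable_fun setT h.
    apply: measurableT_comp => //; apply: measurable_fun_pair => //.
    by apply: measurableT_comp => //; exact: measurable_bit.
  have h0 p : (0 <= h p)%E by exact: f0.
  exact: (@measurable_fun_fubini_tonelli_F _ _ _ _ _ P h mh h0).
have g0 s : (0 <= g s)%E by apply: integral_ge0.
have step kappa : injective kappa ->
    P (digit_sum kappa m.+1 @^-1` A) = (\int[P]_v g (digit_sum kappa m v))%E.
  move=> injk.
  have -> : P (digit_sum kappa m.+1 @^-1` A) =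
      (\int[P]_v f (digit_sum kappa m v, bit (kappa m) v))%E.
    rewrite -[_ @^-1` _]setIT -integral_indic//.
      by apply: eq_integral => v _; rewrite /f/= -digit_sumS.
    by rewrite -[X in measurable X]setTI; exact: measurable_digit_sum.
  have mk : measurable_fun setT (digit_sum kappa m) by exact: measurable_digit_sum.
  rewrite (ge0_integral_independent_pair mk (measurable_bit (kappa m)) _ mf f0).
  - apply: eq_integral => v _; rewrite /g.
    pose F y := f (digit_sum kappa m v, y).
    have mF : measurable_fun setT F by exact: measurable_fun_pair2.
    have F0 y : (0 <= F y)%E by exact: f0.
    transitivity (\int[P]_y F (bit_rv P (kappa m) y))%E; first by [].
    rewrite -(@ge0_integral_distribution _ _ _ _ _ P (bit_rv P (kappa m)) F)//.
    rewrite (eq_measure_integral (distribution P (bit_rv P 0))).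
      by rewrite ge0_integral_distribution.
    by move=> B mB _; exact: (bit_law uniformP).
  - move=> B C mB mC.
    apply: (family_sigma_independent (bits_independent uniformP)
      (J1 := [set kappa k | k in [set k | (k < m)%N]]) (J2 := [set kappa m])).
    + by apply/seteqP; split => // _ [[k /= km <-]] /injk kE; rewrite kE ltnn in km.
    + rewrite -[X in <<s _ >> X]setTI.
      by apply: measurable_digit_sum_family => // k km; exists k.
    + rewrite -[X in <<s _ >> X]setTI.
      exact: (@measurable_family_member _ _ _ _ _ (bit_rv P) _ (kappa m)).
rewrite (step iota inj) (step id (fun _ _ => id)).
have transfer kappa : (\int[P]_v g (digit_sum kappa m v) =
    \int[pushforward P (digit_sum kappa m : R -> R)]_s g s)%E.
  have := ge0_integral_pushforward (measurable_digit_sum kappa m) P measurableT mg.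
  by rewrite preimage_setT => ->.
pose S kappa : {mfun R >-> R} := HB.pack (digit_sum kappa m)
  (isMeasurableFun.Build _ _ _ _ _ (measurable_digit_sum kappa m)).
transitivity (\int[distribution P (S iota)]_s g s)%E; first exact: transfer.
transitivity (\int[distribution P (S id)]_s g s)%E; last exact/esym/transfer.
by apply: eq_measure_integral => B mB _; exact: IH.
Qed.

(** After m digits the error is 2 ^ - m times the m-th iterate of the doubling map,
    which stays in ]0, 1]. *)
Lemma binary_id v : 0 < v -> v <= 1 -> binary id v = v.
Proof.
have dbl w : 0 < w <= 1 -> 0 < doubling w <= 1.
  rewrite /doubling /half_bit indicE => /andP[w0 w1].
  have [wh|wh] := leP w 2^-1.
    by rewrite memNset/= ?in_itv/= ?andbT; [lra|apply/negP; rewrite -leNgt].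
  by rewrite mem_set/= ?in_itv/= ?wh//=; lra.
move=> v0 v1; have iterP m : 0 < iter m doubling v <= 1.
  by elim: m => [|m IH]; [rewrite v0 v1|exact: dbl].
have expand m : v = digit_sum id m v + 2^-1 ^+ m * iter m doubling v.
  elim: m => [|m IH]; first by rewrite /digit_sum big_ord0 add0r expr0 mul1r.
  rewrite [LHS]IH digit_sumS /bit iterS /doubling exprS -addrA; congr (_ + _).
  by field.
apply/eqP; rewrite eq_le; apply/andP; split.
  rewrite leNgt; apply/negP => /lt_binary[m]; rewrite {1}(expand m) ltNge lerDl.
  by have /andP[/ltW i0 _] := iterP m; rewrite mulr_ge0 ?exprn_ge0 ?invr_ge0.
apply/ler_addgt0Pr => e e0.
have : \forall m \near \oo, 2^-1 ^+ m < e.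
  have : (2^-1 : R) ^+ m @[m --> \oo] --> 0.
    by apply: cvg_expr; rewrite ger0_norm ?invr_ge0// invf_lt1 ?ltr1n.
  by move=> /cvgr_lt; apply.
move=> [m _ /(_ m (leqnn m))] /= me.
have le_binary : digit_sum id m v <= binary id v.
  by apply: (ub_le_sup (digit_sum_sup id v).2); exists m.
have /andP[_ i1] := iterP m.
rewrite {1}(expand m); apply: lerD => //.
by rewrite (le_trans _ (ltW me))// ler_piMr ?exprn_ge0 ?invr_ge0.
Qed.

(** Any sequence of distinct digits yields a uniform variable: its law is that of the
    sequence of all digits, which gives back the point itself. *)
Lemma binary_tail iota x : injective iota -> 0 <= x -> x <= 1 ->
  P (binary iota @^-1` `]x, +oo[) = (1 - x)%:E.
Proof.
move=> inj x0 x1.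
have tail kappa : P (digit_sum kappa m @^-1` `]x, +oo[) @[m --> \oo] -->
    P (binary kappa @^-1` `]x, +oo[).
  have -> : binary kappa @^-1` `]x, +oo[ =
      \bigcup_m (digit_sum kappa m @^-1` `]x, +oo[).
    apply/seteqP; split => v /=; rewrite in_itv/= andbT.
      by move=> /lt_binary[m xm]; exists m => //=; rewrite in_itv/= andbT.
    move=> [m _] /=; rewrite in_itv/= andbT => xm; apply/lt_binary.
    by exists m.
  apply: nondecreasing_cvg_mu.
  - by move=> m; rewrite -[X in measurable X]setTI; exact: measurable_digit_sum.
  - apply: bigcup_measurable => m _.
    by rewrite -[X in measurable X]setTI; exact: measurable_digit_sum.
  - move=> m n mn; apply/subsetPset => v /=; rewrite !in_itv/= !andbT => xm.
    by apply: (lt_le_trans xm); apply: digit_sum_nd.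
have eq_lim : P (binary iota @^-1` `]x, +oo[) = P (binary id @^-1` `]x, +oo[).
  apply: (cvg_unique _ (tail iota)) => //.
  rewrite (_ : (fun m => P (digit_sum iota m @^-1` `]x, +oo[)) =
      (fun m => P (digit_sum id m @^-1` `]x, +oo[))); first exact: tail.
  by apply/funext => m; exact: digit_sum_law.
rewrite eq_lim -uniformP//.
have mid : measurable (binary id @^-1` `]x, +oo[).
  by rewrite -[X in measurable X]setTI; exact: measurable_binary.
have null : P (~` `]0, 1]%classic) = 0%E.
  rewrite -[`]0, 1]%classic]/(_) probability_setC//.
  have -> : `]0, 1]%classic = (`]0, +oo[ : set R) `\` (`]1, +oo[ : set R).
    apply/seteqP; split => v /=; rewrite !in_itv/= !andbT.
      by move=> /andP[-> v1]; split => //; apply/negP; rewrite -leNgt.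
    by move=> [-> /negP]; rewrite -leNgt.
  have PD : P (`]0%R, +oo[%classic `\` `]1%R, +oo[%classic) =
      (P `]0%R, +oo[%classic - P (`]0%R, +oo[%classic `&` `]1%R, +oo[%classic))%E.
    apply: measureD => //.
    by rewrite (le_lt_trans (probability_le1 _ _))// ltry.
  rewrite PD setIidr; last by move=> v /=; rewrite !in_itv/= !andbT; lra.
  rewrite !uniformP// subrr subr0 sube0.
  by rewrite subee.
have mN : measurable (~` `]0, 1]%classic : set R) by exact: measurableC.
rewrite [LHS](measure_setD_null mN null)// [RHS](measure_setD_null mN null)//.
congr (P _); apply/seteqP; split => v /= [h /contrapT v01]; split => //;
  move: (v01) h => /=; rewrite !in_itv/= !andbT => /andP[v0 v1];
  by rewrite ?binary_id// => h; apply; rewrite in_itv/= v0 v1.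
Qed.

End binary_expansion.

(** * Independent families with prescribed laws *)

Section independent_family.
Context {R : realType}.

(* The known densities are taken with respect to Lebesgue measure, on a copy of R
   which has its own measurable structure; the identity brings their laws back. *)
Let idR : measurableTypeR R -> R := idfun.
Let midR : measurable_fun setT idR.
Proof. exact: (@measurable_id _ (measurableTypeR R) setT). Qed.
Let idR_mfun : {mfun measurableTypeR R >-> R} :=
  HB.pack idR (isMeasurableFun.Build _ _ _ _ _ midR).

Lemma exists_uniform_law : exists P : probability R R,
  forall x : R, 0 <= x -> x <= 1 -> P `]x, +oo[%classic = (1 - x)%:E.
Proof.
exists (distribution (uniform_prob (@ltr01 R)) idR_mfun) => x x0 x1.
rewrite /distribution /pushforward /= preimage_id /uniform_prob integral_uniform_pdf.
have -> : `]x, +oo[ `&` `[0, 1] = `]x, 1]%classic.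
  apply/seteqP; split => y /=; rewrite !in_itv/= ?andbT; first by move=> [-> /andP[]].
  by move=> /andP[xy y1]; split; rewrite ?xy// y1 (le_trans x0 (ltW xy)).
rewrite (eq_integral (cst 1%E)); last first.
  move=> y; rewrite inE/= in_itv/= => /andP[xy y1].
  by rewrite /uniform_pdf y1 (le_trans x0 (ltW xy))/= subr0 invr1.
rewrite integral_cst//= mul1e lebesgue_measure_itv/= lte_fin.
have [_|] := ltP x 1; first by rewrite EFinB.
by move=> x1'; rewrite (_ : x = 1) ?subrr//; apply/eqP; rewrite eq_le x1.
Qed.

Lemma exists_exponential_law (lambda : R) : 0 < lambda ->
  exists nu : probability R R, forall A, measurable A ->
    nu A = exponential_prob lambda A.
Proof.
move=> lambda_gt0.
(* The probability structure depends on the proof that the rate is positive,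
   which cannot be inferred from the measure. *)
pose expo :=
  exponential_distribution_exponential_prob__canonical__probability_measure_Probability
    lambda_gt0.
by exists (distribution expo idR_mfun).
Qed.

(** The digits of a single uniform point are distributed, through a pairing
    function, into disjoint infinite sequences, one for each index. Each of them
    makes a uniform variable, and its quantile function gives it the prescribed
    law; independence is that of disjoint sets of digits. *)
Lemma exists_independent_family (I : countType) (nu : I -> probability R R) :
  exists (d : measure_display) (T : measurableType d) (P : probability T R)
    (X : I -> {RV P >-> R}), mutually_independent X /\
    forall i (A : set R), measurable A -> distribution P (X i) A = nu i A.
Proof.
have [P uniformP] := exists_uniform_law.
pose iota (i : I) (k : nat) : nat := pickle (pickle i, k).
have iota_inj i : injective (iota i).
  by move=> k l /(pcan_inj pickleK)[].
have iota_disj i j k l : iota i k = iota j l -> i = j.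
  by move=> /(pcan_inj pickleK)[] /(pcan_inj pickleK).
have mX i : measurable_fun setT (quantile (nu i) \o binary (iota i)).
  apply: measurableT_comp; first exact: measurable_quantile.
  exact: (measurable_binary P).
pose X i : {RV P >-> R} := HB.pack (quantile (nu i) \o binary (iota i))
  (isMeasurableFun.Build _ _ _ _ _ (mX i)).
exists _, _, P, X; split; last first.
  move=> i A mA.
  have tail x x0 x1 := binary_tail (x := x) uniformP (iota_inj i) x0 x1.
  exact: (quantile_law (nu i) (measurable_binary P (iota i)) tail mA).
move=> s A us mA.
pose J (r : seq I) : set nat := [set n | exists2 i, i \in r & exists k, n = iota i k].
have EJ r i : i \in r -> <<s cylinders (bit_rv P) (J r) >> (X i @^-1` A i).
  move=> ir.
  have mB : measurable (quantile (nu i) @^-1` A i).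
    by rewrite -[X in measurable X]setTI; exact: measurable_quantile.
  have iotaJ k : J r (iota i k) by exists i => //; exists k.
  have := measurable_binary_family (P := P) iotaJ measurableT mB.
  by rewrite setTI.
have bigJ r : <<s cylinders (bit_rv P) (J r) >> (\big[setI/setT]_(i <- r) X i @^-1` A i).
  rewrite big_seq; apply: big_rec => [|i E ir sE].
    exact: (@measurableT _ (family_sigma (bit_rv P) (J r))).
  exact: (@measurableI _ (family_sigma (bit_rv P) (J r)) _ _ (EJ _ _ ir) sE).
elim: s us => [|i s IH] /=; first by rewrite !big_nil probability_setT.
move=> /andP[nis us]; rewrite !big_cons -IH//.
apply: (family_sigma_independent (bits_independent uniformP) (J1 := J [:: i]) (J2 := J s)) => //.
- apply/seteqP; split => // n [[j + [k ->]] [j' j's [l]]].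
  rewrite inE => /eqP -> /iota_disj ij'; move: nis.
  by rewrite ij' j's.
- by apply: EJ; rewrite inE.
Qed.

End independent_family.

(** * Existence of compound Poisson processes *)

Section arrival_divergence.
Context {d : measure_display} {T : measurableType d} {R : realType}
  (P : probability T R) (lambda : R) (tau xi : nat -> {RV P >-> R}).
Hypothesis lambda_gt0 : 0 < lambda.
Hypothesis indX : mutually_independent
  (fun k : nat + nat => match k with inl i => tau i | inr i => xi i end).
Hypothesis tau_law : forall i (A : set R), measurable A ->
  distribution P (tau i) A = exponential_prob lambda A.

(** On nonnegative clocks, exp (lambda x) >= 1: the indicator of the event is at
    most the weight for k = 0, whose integral is known. *)
Lemma arrival_le_probability n t : 0 <= t ->
  (P (arrival tau n @^-1` `]-oo, t]) <= ((lambda * t) ^+ n / n`!%:R)%:E)%E.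
Proof.
move=> t0.
have marr : measurable_fun setT (arrival tau n) := measurable_arrival tau xi n.
have mA : measurable (arrival tau n @^-1` `]-oo, t]).
  by rewrite -[X in measurable X]setTI; exact: marr.
have := integral_arrival_weight lambda_gt0 indX tau_law n 0 t0.
rewrite addn0 fact0 mulr1 -exprMn => <-; rewrite (probabilityE P mA).
have mweight : measurable_fun setT
    (fun w => (arrival_weight lambda t 0 (arrival tau n w))%:E).
  by apply/measurable_EFinP; apply: measurableT_comp => //;
    exact: measurable_arrival_weight.
apply: ae_ge0_le_integral => //.
- by apply/measurable_EFinP; exact: measurable_indic.
- by move=> w _; rewrite lee_fin arrival_weight_ge0.
- apply: filterS (clock_ge0_ae tau_law) => w tau0 _.
  rewrite lee_fin /arrival_weight expr0 mulr1 [\1_(`]-oo, t]%classic) _]indicE.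
  rewrite indicE (_ : (w \in _) = (arrival tau n w \in `]-oo, t]%classic)); last first.
    by apply/idP/idP; rewrite !inE.
  rewrite -[leLHS]mul1r ler_wpM2r// -[leLHS]expR0 ler_expR mulr_ge0 ?(ltW lambda_gt0)//.
  by apply: sumr_ge0.
Qed.

(** The bound (lambda m) ^ n / n! tends to 0, so that almost surely no natural number
    m bounds all the arrivals. *)
Lemma arrival_unbounded_ae :
  {ae P, forall w, forall t, exists n, t < arrival tau n w}.
Proof.
have marr n : measurable_fun setT (arrival tau n) := measurable_arrival tau xi n.
have mA n (t : R) : measurable (arrival tau n @^-1` `]-oo, t]).
  by rewrite -[X in measurable X]setTI; exact: marr.
have null : P.-negligible (\bigcup_(m : nat) \bigcap_n (arrival tau n @^-1` `]-oo, m%:R])).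
  apply: negligible_bigcup => m.
  have mB : measurable (\bigcap_n (arrival tau n @^-1` `]-oo, m%:R])).
    by apply: bigcapT_measurable => n; exact: mA.
  exists (\bigcap_n (arrival tau n @^-1` `]-oo, m%:R])); split => //.
  apply/eqP; rewrite eq_le measure_ge0 andbT.
  have cvg0 : (exp_coeff (lambda * m%:R) n)%:E @[n --> \oo] --> 0%E.
    by apply/cvg_EFin; [exact: nearW|exact: cvg_exp_coeff].
  apply: (cvge_to_ge cvg0); apply: nearW => n.
  apply: (le_trans _ (arrival_le_probability n (ler0n _ m))).
  by apply: le_measure; rewrite ?inE// => w /(_ n I).
apply: negligibleS null => w /= /existsNP[t /forallNP tn].
exists (Num.truncn t).+1 => // n _ /=; rewrite in_itv/=.
have := tn n; move=> /negP; rewrite -leNgt => /le_trans; apply.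
by rewrite ltW// truncnS_gt.
Qed.

End arrival_divergence.

(** The definition of a compound Poisson process with its rate, clocks, jumps and
    counts as parameters, so that several statements can share them. *)
Definition compound_poisson_data {d : measure_display} {T : measurableType d}
    {R : realType} (P : probability T R) (lambda : R)
    (tau xi : nat -> {RV P >-> R}) (N : R -> T -> nat) (Y : R -> {RV P >-> R}) : Prop :=
  [/\ 0 < lambda,
      mutually_independent
        (fun k : nat + nat => match k with inl i => tau i | inr i => xi i end),
      (forall (i : nat) (A : set R), measurable A ->
         distribution P (tau i) A = exponential_prob lambda A),
      (forall (i : nat) (A : set R), measurable A ->
         distribution P (xi i) A = distribution P (xi 0%N) A) /\
      (forall i : nat, P [set w | 0 < xi i w] = 1%E)
    & {ae P, forall w, forall t : R, 0 <= t ->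
         [/\ \sum_(i < N t w) tau i w <= t,
             t < \sum_(i < (N t w).+1) tau i w
           & Y t w = \sum_(i < N t w) xi i w]}].

(** Independent clocks and jumps exist on some space, and the count is read off
    them. It has to be chosen measurably also on the null event where the arrivals
    are not increasing or stay bounded: the events of the counts are made
    disjoint, and the count is 0 where none of them occurs. *)
Lemma exists_compound_poisson {R : realType} (lambda : R) (nu : probability R R) :
  0 < lambda -> nu `]0, +oo[%classic = 1%E ->
  exists (d : measure_display) (T : measurableType d) (P : probability T R)
    (tau xi : nat -> {RV P >-> R}) (N : R -> T -> nat) (Y : R -> {RV P >-> R}),
    compound_poisson_data lambda tau xi N Y /\
    forall A, measurable A -> distribution P (xi 0%N) A = nu A.
Proof.
move=> lambda_gt0 nu_pos.
have [expo expoE] := exists_exponential_law lambda_gt0.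
pose law (k : nat + nat) := if k is inl _ then expo else nu.
have [d [T [P [X [indX lawX]]]]] := exists_independent_family law.
pose tau i := X (inl i); pose xi i := X (inr i).
have indtx : mutually_independent
    (fun k : nat + nat => match k with inl i => tau i | inr i => xi i end).
  by rewrite (_ : (fun _ => _) = X)//; apply/funext => -[].
have tau_law i (A : set R) : measurable A ->
    distribution P (tau i) A = exponential_prob lambda A.
  by move=> mA; rewrite lawX// expoE.
have xi_law i (A : set R) : measurable A -> distribution P (xi i) A = nu A.
  by move=> mA; rewrite lawX.
pose first (t : R) := seqDU (count_event tau t).
have mfirst t n : measurable (first t n).
  apply: measurableD; first exact: (measurable_count_event tau xi).
  by apply: bigsetU_measurable => k _; exact: (measurable_count_event tau xi).
pose N (t : R) w : nat := xget 0%N [set n | first t n w].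
have NE t n w : first t n w -> N t w = n.
  move=> fn; rewrite /N; case: xgetP => [m _ fm|/(_ n)//].
  by apply: (@trivIset_seqDU _ (count_event tau t)) => //; exists w.
have mxi n : measurable_fun setT (jump_sum xi n) := measurable_jump_sum xi n.
have mY t : measurable_fun setT (fun w => jump_sum xi (N t w) w).
  apply: measurable_fun_rays => x.
  have -> : [set w | x < jump_sum xi (N t w) w] =
      \bigcup_n (first t n `&` jump_sum xi n @^-1` `]x, +oo[) `|`
      (~` (\bigcup_n first t n) `&` jump_sum xi 0 @^-1` `]x, +oo[).
    apply/seteqP; split => w /=; last first.
      move=> [[n _ /= [fn]]|[nf]]; rewrite in_itv/= andbT; first by rewrite (NE _ _ _ fn).
      rewrite /N; case: xgetP => // m _ fm; case: nf; exists m => //.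
    move=> xw; have [[n _ fn]|nf] := pselect ((\bigcup_n first t n) w).
      by left; exists n => //; split => //=; rewrite in_itv/= andbT -(NE _ _ _ fn).
    right; split => //=; rewrite in_itv/= andbT; move: xw.
    by rewrite /N; case: xgetP => // m _ fm; case: nf; exists m.
  have mjump n : measurable (jump_sum xi n @^-1` `]x, +oo[).
    by rewrite -[X in measurable X]setTI; exact: mxi.
  apply: measurableU.
    by apply: bigcup_measurable => n _; exact: measurableI.
  apply: measurableI => //; apply: measurableC.
  by apply: bigcup_measurable => n _; exact: mfirst.
pose Y t : {RV P >-> R} := HB.pack (fun w => jump_sum xi (N t w) w)
  (isMeasurableFun.Build _ _ _ _ _ (mY t)).
exists d, T, P, tau, xi, N, Y; split; last exact: xi_law.
split => //.
- split=> [i A mA|i]; first by rewrite !xi_law.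
  have -> : [set w | 0 < xi i w] = xi i @^-1` `]0, +oo[.
    by apply/seteqP; split => w /=; rewrite in_itv/= andbT.
  by rewrite -nu_pos -(xi_law i).
- apply: filterS2 (clock_ge0_ae tau_law)
    (arrival_unbounded_ae lambda_gt0 indtx tau_law) => w tau0 unb t t0.
  have [n tn] : exists n, count_event tau t n w.
    have [k tk] := unb t; elim: k tk => [|k IH] tk.
      by move: tk; rewrite /arrival big_ord0 ltNge t0.
    have [kt|/IH//] := leP (arrival tau k w) t.
    by exists k.
  have [m _ fm] : (\bigcup_m first t m) w by rewrite -seqDU_bigcup_eq; exists n.
  have [h1 h2] := subset_seqDU fm.
  by rewrite (NE _ _ _ fm); split => //; rewrite /= (NE _ _ _ fm).
Qed.

(** * Laplace exponent and Levy measure *)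

Section compound_poisson_laplace.
Context {d : measure_display} {T : measurableType d} {R : realType}
  (P : probability T R) (lambda : R) (tau xi : nat -> {RV P >-> R})
  (N : R -> T -> nat) (Y : R -> {RV P >-> R}).
Hypothesis dataY : compound_poisson_data lambda tau xi N Y.

Definition jump_transform (z : R) : R := fine (\int[P]_w (expR (- z * xi 0%N w))%:E).

Let mexp z (X : {RV P >-> R}) : measurable_fun setT (fun w => (expR (- z * X w))%:E).
Proof.
apply/measurable_EFinP; apply: measurableT_comp => //.
exact: measurable_funM.
Qed.

Let pos : set T := [set w | 0 < xi 0%N w].

Let mpos : measurable pos.
Proof.
rewrite (_ : pos = xi 0%N @^-1` `]0, +oo[).
  by rewrite -[X in measurable X]setTI; exact: measurable_funP.
by apply/seteqP; split => w /=; rewrite in_itv/= andbT.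
Qed.

Let Ppos : P pos = 1%E.
Proof. by have [_ _ _ [_ ->] _] := dataY. Qed.

Let Pnonpos : P (~` pos) = 0%E.
Proof. by rewrite probability_setC// Ppos subee. Qed.

(** The transform is finite because the jumps are almost surely positive. *)
Lemma jump_transformE z : 0 <= z ->
  (\int[P]_w (expR (- z * xi 0%N w))%:E)%E = (jump_transform z)%:E.
Proof.
move=> z0; rewrite fineK// ge0_fin_numE; last first.
  by apply: integral_ge0 => w _; rewrite lee_fin expR_ge0.
apply: (@le_lt_trans _ _ (\int[P]_w (cst 1%E w))%E); last first.
  by rewrite integral_cst// mul1e (le_lt_trans (probability_le1 _ _))// ltry.
apply: ae_ge0_le_integral => //.
exists (~` pos); split.
- exact: measurableC.
- exact: Pnonpos.
- move=> w /= /not_implyP[_ le1] /ltW xi0; apply: le1.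
  by rewrite lee_fin expR_le1 mulNr oppr_le0 mulr_ge0.
Qed.

Lemma compound_poisson_transformE t z : 0 <= t -> 0 <= z ->
  (\int[P]_w (expR (- z * Y t w))%:E =
   (expR (- (t * (lambda * (1 - jump_transform z)))))%:E)%E.
Proof.
move=> t0 z0; have [lambda_gt0 indX tau_law [xi_law _] YN] := dataY.
apply: (compound_poisson_transform lambda_gt0 indX tau_law xi_law t0) => //.
- apply: filterS YN => w /(_ t t0)[N1 N2 YE].
  by exists (N t w).
- exact: jump_transformE.
Qed.

Lemma compound_poisson_laplace_exponent z : 0 <= z ->
  laplace_exponent Y z = lambda * (1 - jump_transform z).
Proof.
move=> z0; rewrite /laplace_exponent unlock.
rewrite (compound_poisson_transformE ler01 z0) /= expRK mul1r opprK//.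
Qed.

Lemma compound_poisson_transform_exponent t z : 0 <= t -> 0 <= z ->
  (\int[P]_w (expR (- z * Y t w))%:E = (expR (- (t * laplace_exponent Y z)))%:E)%E.
Proof.
by move=> t0 z0; rewrite compound_poisson_transformE// compound_poisson_laplace_exponent.
Qed.

(** The rate times the law of a jump. *)
Lemma compound_poisson_levy_measure :
  exists Pi : {measure set R -> \bar R}, is_levy_measure Y Pi.
Proof.
have [lambda_gt0 _ _ _ _] := dataY.
pose nu := distribution P (xi 0%N).
exists (mscale (NngNum (ltW lambda_gt0)) nu).
have nu_neg : nu `]-oo, 0]%classic = 0%E.
  rewrite -[RHS]Pnonpos; congr (P _); apply/seteqP; split => w /=; rewrite in_itv/=.
    by move=> w0; apply/negP; rewrite -leNgt.
  by move=> /negP; rewrite -leNgt.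
have PiE A : mscale (NngNum (ltW lambda_gt0)) nu A = (lambda%:E * nu A)%E by [].
split; first by rewrite [LHS]PiE nu_neg mule0.
move=> z z0; rewrite compound_poisson_laplace_exponent//.
have mf (D : set R) : measurable_fun D (fun x : R => (1 - expR (- z * x))%:E).
  apply/measurable_EFinP; apply: measurable_funTS; apply: measurable_funB => //.
  apply: measurableT_comp => //; exact: measurable_funM.
have f0 (x : R) : `]0, +oo[%classic x -> (0 <= (1 - expR (- z * x))%:E)%E.
  rewrite /= in_itv/= andbT => x0.
  by rewrite lee_fin subr_ge0 expR_le1 mulNr oppr_le0 mulr_ge0// ltW.
rewrite ge0_integral_mscale//= EFinM; congr (_ * _)%E.
have mexpz (D : set R) : measurable_fun D (fun x : R => (expR (- z * x))%:E).
  exact: measurable_expRN.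
have total : (\int[nu]_(x in `]0%R, +oo[) (1 - expR (- z * x))%:E +
    (jump_transform z)%:E = 1)%E.
  have -> : ((jump_transform z)%:E = \int[nu]_(x in `]0%R, +oo[) (expR (- z * x))%:E)%E.
    rewrite -jump_transformE// -(ge0_integral_distribution (xi 0%N) (mexpz setT)); last first.
      by move=> x; rewrite lee_fin expR_ge0.
    rewrite (ge0_negligible_integral _ _ _ _ nu_neg)//.
    by rewrite setTD setCitvl.
  rewrite -ge0_integralD//.
  rewrite (eq_integral (cst 1%E)); last by move=> x _; rewrite -EFinD subrK.
  rewrite integral_cst// mul1e -Ppos.
  by congr (P _); apply/seteqP; split => w /=; rewrite in_itv/= andbT.
rewrite -[RHS](@addeK _ (jump_transform z)%:E)// total.
by rewrite -EFinB.
Qed.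

End compound_poisson_laplace.

(** * Series expansions of the Lambert exponent *)

Section poisson_lambert.
Context {R : realType} (c : R).
Hypothesis c_gt0 : 0 < c.
Implicit Types (t z : R) (n k : nat).

(** The solution u in ]0, 1] of u exp (- u) = c exp (- c - z); the exponent is
    the value of this root at 0 minus its value at z. *)
Definition lambert_root z : R := - lambertW0 (- (c * expR (- c - z))).

Lemma lambert_rootP z : 0 <= z ->
  [/\ 0 < lambert_root z, lambert_root z <= 1 &
      lambert_root z * expR (- lambert_root z) = c * expR (- c) * expR (- z)].
Proof.
move=> z0; have x0 : 0 < c * expR (- c - z) by rewrite mulr_gt0 ?expR_gt0.
have x1 : c * expR (- c - z) <= expR (- 1).
  apply: (le_trans _ (mulexpRN_le c_gt0)).
  by rewrite ler_wpM2l ?(ltW c_gt0)// ler_expR gerBl.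
have [u [u0 u1 ux uW]] := lambertW0N x0 x1.
rewrite /lambert_root uW opprK; split => //.
by rewrite ux expRD mulrA.
Qed.

(** The value 1 is reached only at the maximum 1 / e of u exp (- u), hence at z = 0
    if at all. *)
Lemma lambert_root_lt1 z : 0 < z -> lambert_root z < 1.
Proof.
move=> z0; have [u0 u1 uE] := lambert_rootP (ltW z0).
rewrite lt_neqAle u1 andbT; apply/eqP => u_eq1.
have := mulexpRN_le c_gt0; rewrite leNgt => /negP; apply.
rewrite -[ltLHS]mul1r -[X in X * _]u_eq1 -{1}u_eq1 uE -{2}[c * _]mulr1.
by rewrite ltr_pM2l ?mulr_gt0 ?expR_gt0// expR_lt1 oppr_lt0.
Qed.

Definition levy_weight n : R :=
  if n is m.+1 then n%:R ^+ m / n`!%:R * (c * expR (- c)) ^+ n else 0.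

Lemma levy_weight_ge0 n : 0 <= levy_weight n.
Proof.
by case: n => //= n; rewrite mulr_ge0 ?divr_ge0 ?exprn_ge0// mulr_ge0 ?expR_ge0// ltW.
Qed.

(** The tree series at u exp (- u), with the exponential exp (- z) distributed over
    the powers. *)
Lemma levy_weight_series z : 0 <= z ->
  (\sum_(0 <= k <oo) (levy_weight k * expR (- (z * k%:R)))%:E =
   (lambert_root z)%:E)%E.
Proof.
move=> z0; have [u0 u1 uE] := lambert_rootP z0.
rewrite -(tree_series_inverse (ltW u0) u1) uE /tree_series.
rewrite (nneseries_split 0 1); last first.
  by move=> k _; rewrite lee_fin mulr_ge0 ?levy_weight_ge0 ?expR_ge0.
rewrite add0n big_nat1 mul0r add0e [LHS]ereal_series [RHS]ereal_series.
apply: eq_eseriesr => -[//|k] _; congr EFin.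
by rewrite /= (exprMn _ (c * _)) -(expRM_natr _ (- z)) mulNr mulrA.
Qed.

Definition process_weight t n : R :=
  expR (- (t * lambert_root 0)) * (abel_coeff t n / n`!%:R * (c * expR (- c)) ^+ n).

Lemma process_weight_ge0 t n : 0 <= t -> 0 <= process_weight t n.
Proof.
move=> t0; rewrite mulr_ge0 ?expR_ge0// mulr_ge0 ?divr_ge0 ?abel_coeff_ge0//.
by rewrite exprn_ge0// mulr_ge0 ?expR_ge0// ltW.
Qed.

(** The expansion of exp (t T(x)) at x = u exp (- u), which requires u < 1, whence
    0 < z. *)
Lemma process_weight_series t z : 0 <= t -> 0 < z ->
  (\sum_(0 <= k <oo) (process_weight t k * expR (- (z * k%:R)))%:E =
   (expR (- (t * (lambert_root 0 - lambert_root z))))%:E)%E.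
Proof.
move=> t0 z0; have [u0 u1 uE] := lambert_rootP (ltW z0).
have [_ abelE] := tree_series_abel (ltW u0) (lambert_root_lt1 z0).
transitivity ((expR (- (t * lambert_root 0)))%:E *
    abel_series t (c * expR (- c) * expR (- z)))%E.
  rewrite -nneseriesZl; last first.
    move=> k _; rewrite lee_fin mulr_ge0 ?divr_ge0 ?abel_coeff_ge0//.
    by rewrite exprn_ge0// !mulr_ge0 ?expR_ge0// ltW.
  apply: eq_eseriesr => k _; rewrite -EFinM; congr EFin.
  by rewrite /process_weight (exprMn _ (c * _)) -(expRM_natr _ (- z)) mulNr !mulrA.
rewrite -uE abelE// -EFinM -expRD; congr (expR _)%:E; ring.
Qed.

(** As u <= 1, the root is at most e times u exp (- u). *)
Lemma lambert_root_cvg0 : lambert_root m%:R @[m --> \oo] --> 0.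
Proof.
apply: (@squeeze_cvgr _ _ _ _ (cst 0)
  (fun m : nat => expR 1 * (c * expR (- c)) * expR (- m%:R))).
- apply: nearW => m /=.
  have [u0 u1 uE] := lambert_rootP (ler0n R m).
  rewrite (ltW u0)/= -mulrA -uE mulrCA ler_peMr ?(ltW u0)//.
  by rewrite -expRD -[leLHS]expR0 ler_expR subr_ge0.
- exact: cvg_cst.
- rewrite -[X in _ --> X](mulr0 (expR 1 * (c * expR (- c)))).
  by apply: cvgM; [exact: cvg_cst|exact: cvgn_expR].
Qed.

Lemma process_weightE (a t : R) n : a = c - lambert_root 0 -> 0 < t ->
  process_weight t n =
  c * t * ((c * (n%:R + t)) ^ (n%:Z - 1)) / n`!%:R * expR (- (c * (n%:R + t)) + a * t).
Proof.
move=> -> t0; rewrite /process_weight.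
have -> : - (c * (n%:R + t)) + (c - lambert_root 0) * t =
    - (t * lambert_root 0) + - c * n%:R by ring.
rewrite [in RHS]expRD expRM_natr exprMn.
case: n => [|n].
  rewrite mulr0n add0r (_ : 0%:Z - 1 = -1)// exprN1 !expr0 fact0 !divr1 !mulr1.
  by rewrite divff ?mul1r// mulf_neq0 ?gt_eqF.
rewrite intS addrAC subrr add0r -exprnP exprMn /= (addrC t) exprS.
ring.
Qed.

End poisson_lambert.

(** * The process with the Lambert exponent *)

Section as_probability.
Context {d : measure_display} {T : measurableType d} {R : realType}.
Context (m : {measure set T -> \bar R}) (mT : m setT = 1%E).

(** The hypothesis on the mass is an argument, so that the structure of probability
    can be attached to the function. *)
Definition as_probability of m setT = 1%E : set T -> \bar R := m.
HB.instance Definition _ := Measure.on (as_probability mT).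
HB.instance Definition _ :=
  Measure_isProbability.Build _ _ _ (as_probability mT) mT.

End as_probability.

Section poisson_lambert_process.
Context {R : realType} (c : R).
Hypothesis c_gt0 : 0 < c.

(** The hypothesis gives the integrals of 1 - exp (- z x) only. By monotone convergence
    along z = m the exponent tends to the total mass, which is therefore finite;
    subtracting, the Laplace transform itself is known, and its expansion is that
    of the weights. *)
Lemma levy_measure_atoms (Pi : {measure set R -> \bar R}) :
  Pi `]-oo, 0]%classic = 0%E ->
  (forall z, 0 <= z -> (lambert_root c 0 - lambert_root c z)%:E =
    (\int[Pi]_(x in `]0%R, +oo[) (1 - expR (- z * x))%:E)%E) ->
  Pi (~` [set x | exists n : nat, (0 < n)%N /\ x = n%:R]) = 0%E /\
  forall n : nat, (0 < n)%N -> Pi [set n%:R] = (levy_weight c n)%:E.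
Proof.
move=> Pi_neg laplace.
have mf z (D : set R) : measurable_fun D (fun x : R => (1 - expR (- z * x))%:E).
  apply/measurable_EFinP; apply: measurable_funTS; apply: measurable_funB => //.
  apply: measurableT_comp => //; exact: measurable_funM.
have f0 z (x : R) : 0 <= z -> `]0, +oo[%classic x -> (0 <= (1 - expR (- z * x))%:E)%E.
  move=> z0; rewrite /= in_itv/= andbT => x0.
  by rewrite lee_fin subr_ge0 expR_le1 mulNr oppr_le0 mulr_ge0// ltW.
have mass : Pi `]0, +oo[%classic = (lambert_root c 0)%:E.
  have lim1 : (lambert_root c 0 - lambert_root c m%:R)%:E @[m --> \oo] -->
      (lambert_root c 0)%:E.
    apply/cvg_EFin; first exact: nearW.
    rewrite -[X in _ --> X]subr0; apply: cvgB; first exact: cvg_cst.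
    exact: lambert_root_cvg0.
  have lim2 : (lambert_root c 0 - lambert_root c m%:R)%:E @[m --> \oo] -->
      Pi `]0, +oo[%classic.
    rewrite (_ : (fun m : nat => _) =
        (fun m : nat => \int[Pi]_(x in `]0%R, +oo[) (1 - expR (- m%:R * x))%:E)%E); last first.
      by apply/funext => m; rewrite laplace.
    have -> : Pi `]0, +oo[%classic = (\int[Pi]_(x in `]0%R, +oo[) (cst 1 x))%E.
      by rewrite integral_cst// mul1e.
    rewrite (eq_integral (fun x : R =>
      limn (fun m : nat => (1 - expR (- m%:R * x))%:E))); last first.
      move=> x; rewrite inE/= in_itv/= andbT => x0; apply/esym/cvg_lim => //.
      apply/cvg_EFin; first exact: nearW.
      rewrite -[X in _ --> X]subr0; apply: cvgB; first exact: cvg_cst.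
      have := @cvg_expRN_natr R 1 x x0; move=> /fine_cvg /=.
      by under eq_fun do rewrite mul1r -mulNr.
    apply: cvg_monotone_convergence => //.
    - by move=> m x; apply: f0.
    - move=> x; rewrite /= in_itv/= andbT => x0 m n mn.
      by rewrite lee_fin lerB// ler_expR !mulNr lerN2 ler_wpM2r ?ler_nat// ltW.
  exact: (cvg_unique _ lim2 lim1).
have transform z : 0 <= z ->
    (\int[Pi]_(x in `]0%R, +oo[) (expR (- z * x))%:E = (lambert_root c z)%:E)%E.
  move=> z0.
  have total : (\int[Pi]_(x in `]0%R, +oo[) (expR (- z * x))%:E +
      (lambert_root c 0 - lambert_root c z)%:E = (lambert_root c 0)%:E)%E.
    rewrite laplace// -ge0_integralD//.
    - rewrite (eq_integral (cst 1%E)) ?integral_cst// ?mul1e//.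
      by move=> x _; rewrite -EFinD addrCA subrr addr0.
    - exact: measurable_expRN.
    - by move=> x; apply: f0.
  rewrite -[LHS](@addeK _ (lambert_root c 0 - lambert_root c z)%:E)// total.
  by rewrite -EFinB; congr EFin; ring.
have mE : measurable (`]0, +oo[%classic : set R) by exact: measurable_itv.
have rfin : (\sum_(0 <= k <oo) (levy_weight c k)%:E < +oo)%E.
  rewrite (eq_eseriesr (g := fun k => (levy_weight c k * expR (- (0 * k%:R)))%:E)).
    by rewrite levy_weight_series// ltry.
  by move=> k _; rewrite mul0r oppr0 expR0 mulr1.
have series (m : nat) : (\int[Pi]_(x in `]0%R, +oo[) (expR (- (0 + m%:R) * x))%:E =
    \sum_(0 <= k <oo) (levy_weight c k * expR (- (m%:R * k%:R)))%:E)%E.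
  by rewrite add0r transform// levy_weight_series.
have [atoms gaps] := laplace_series_unique mE (lexx 0) (levy_weight_ge0 c_gt0) rfin series.
split=> [|n n0]; last first.
  have := atoms n; rewrite mul0r expR0 mulr1 setIC setIidl//.
  by move=> _ ->; rewrite /= in_itv/= andbT ltr0n.
have mpos := @measurable_posn R; have mnat := @measurable_nats R.
apply: (@subset_measure0 _ _ _ Pi _ (`]-oo, 0]%classic `|`
   (`]0, +oo[%classic `\` [set x | exists n : nat, x = n%:R]))) => //.
- exact: measurableC.
- by apply: measurableU => //; exact: measurableD.
- move=> x /= nx; rewrite !in_itv/= andbT; have [x0|x0] := leP x 0; first by left.
  right; split => // -[n xn]; apply: nx; exists n; split => //.
  by rewrite -(ltr0n R) -xn.
- by apply: null_set_setU => //; exact: measurableD.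
Qed.

(** The transform and the generating series of the weights agree on z > 0, and the
    uniqueness of the transform is applied from z = 1 on. *)
Lemma process_atoms {d : measure_display} {T : measurableType d}
    (P : probability T R) (y : {RV P >-> R}) t : 0 <= t ->
  (forall z, 0 <= z -> (\int[P]_w (expR (- z * y w))%:E =
     (expR (- (t * (lambert_root c 0 - lambert_root c z))))%:E)%E) ->
  P [set w | exists n : nat, y w = n%:R] = 1%E /\
  forall n : nat, P [set w | y w = n%:R] = (process_weight c t n)%:E.
Proof.
move=> t0 transform.
pose r k := process_weight c t k * expR (- (1 * k%:R)).
have r0 k : 0 <= r k by rewrite mulr_ge0 ?expR_ge0 ?process_weight_ge0.
have rfin : (\sum_(0 <= k <oo) (r k)%:E < +oo)%E.
  by rewrite process_weight_series// ltry.
have transform_law (m : nat) : (\int[distribution P y]_(x in setT) (expR (- (1 + m%:R) * x))%:E =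
    \sum_(0 <= k <oo) (r k * expR (- (m%:R * k%:R)))%:E)%E.
  rewrite (ge0_integral_distribution y (@measurable_expRN R (1 + m%:R) setT)); last first.
    by move=> x; rewrite lee_fin expR_ge0.
  rewrite transform ?addr_ge0// -process_weight_series ?ltr_pwDl//.
  apply: eq_eseriesr => k _; congr EFin; rewrite /r -mulrA -expRD.
  by congr (_ * expR _); ring.
have [atoms gaps] := laplace_series_unique (@measurableT _ R) ler01 r0 rfin transform_law.
have mnat := @measurable_nats R.
split.
  have PN : distribution P y [set x | exists n : nat, x = n%:R] = 1%E.
    rewrite -[X in distribution P y X]setCK probability_setC; last exact: measurableC.
    by rewrite -setTD gaps sube0.
  exact: PN.
move=> n; have := atoms n; rewrite setTI => h.
transitivity (r n * expR (1 * n%:R))%:E; first exact: h.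
by rewrite /r -mulrA -expRD addNr expR0 mulr1.
Qed.

(** The Levy weights divided by their sum, placed on the natural numbers; the weight
    at 0 vanishes. *)
Lemma exists_jump_law : exists2 nu : probability R R, nu `]0, +oo[%classic = 1%E &
  forall z, 0 <= z -> (\int[nu]_x (expR (- z * x))%:E =
    (lambert_root c z / lambert_root c 0)%:E)%E.
Proof.
have [u_gt0 _ _] := lambert_rootP c_gt0 (lexx 0).
set u := lambert_root c 0 in u_gt0 *.
have w0 k : 0 <= levy_weight c k / u.
  by rewrite divr_ge0 ?levy_weight_ge0// ltW.
pose atom k : {measure set R -> \bar R} := mscale (NngNum (w0 k)) (dirac (k%:R : R)).
pose m : {measure set R -> \bar R} := mseries atom 0.
have mint (D : set R) (f : R -> \bar R) : measurable D -> measurable_fun D f ->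
    (forall x, D x -> 0 <= f x)%E ->
    (\int[m]_(x in D) f x = \sum_(0 <= k <oo)
       ((levy_weight c k / u)%:E * (\d_(k%:R : R) D * f k%:R)))%E.
  move=> mD mf f0; rewrite ge0_integral_measure_series//.
  apply: eq_eseriesr => k _; rewrite ge0_integral_mscale//= integral_dirac//.
have weight_total z : 0 <= z -> (\sum_(0 <= k <oo) ((levy_weight c k / u)%:E *
    (expR (- z * k%:R))%:E) = (lambert_root c z / u)%:E)%E.
  move=> z0.
  transitivity ((u^-1)%:E * \sum_(0 <= k <oo) (levy_weight c k * expR (- (z * k%:R)))%:E)%E.
    rewrite -nneseriesZl => [|k _]; last by rewrite lee_fin mulr_ge0 ?expR_ge0 ?levy_weight_ge0.
    by apply: eq_eseriesr => k _; rewrite -!EFinM mulNr; congr EFin; ring.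
  by rewrite levy_weight_series// -EFinM mulrC.
have mT : m setT = 1%E.
  rewrite -[LHS]mul1e -integral_cst// mint//.
  rewrite -[RHS](_ : (lambert_root c 0 / u)%:E = _); last by rewrite divff// gt_eqF.
  rewrite -weight_total//; apply: eq_eseriesr => k _.
  by rewrite diracT mul1e oppr0 mul0r expR0.
pose nu : probability R R := as_probability mT.
exists nu.
  transitivity (m `]0, +oo[%classic); first by [].
  rewrite -[LHS]mul1e -integral_cst// mint//.
  rewrite -[RHS](_ : (lambert_root c 0 / u)%:E = _); last by rewrite divff// gt_eqF.
  rewrite -weight_total//; apply: eq_eseriesr => -[|k] _.
    by rewrite /= mul0r !mul0e.
  rewrite diracE mem_set ?mul1e ?oppr0 ?mul0r ?expR0//.
  by rewrite /= in_itv/= andbT ltr0n.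
move=> z z0; rewrite -weight_total//.
transitivity (\int[m]_x (expR (- z * x))%:E)%E; first by [].
rewrite mint//.
- by apply: eq_eseriesr => k _; rewrite diracT mul1e.
- exact: measurable_expRN.
Qed.

End poisson_lambert_process.

Theorem proposition3 (R : realType) (c : R) (hc : 0 < c) :
  let PhiY (z : R) : R :=
    lambertW0 (- (c * expR (- c - z))) - lambertW0 (- (c * expR (- c))) in
  let a : R := if c <= 1 then 0 else c + lambertW0 (- (c * expR (- c))) in
  (exists (d : measure_display) (T : measurableType d) (P : probability T R)
          (Y : R -> {RV P >-> R}),
     compound_poisson Y /\
     forall z : R, 0 <= z -> laplace_exponent Y z = PhiY z) /\
  (forall (d : measure_display) (T : measurableType d) (P : probability T R)
          (Y : R -> {RV P >-> R}),
     compound_poisson Y ->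
     (forall z : R, 0 <= z -> laplace_exponent Y z = PhiY z) ->
     [/\ (forall t : R, 0 < t ->
            P [set w | exists n : nat, Y t w = n%:R] = 1%E /\
            forall n : nat,
              P [set w | Y t w = n%:R] =
              (c * t * ((c * (n%:R + t)) ^ (n%:Z - 1)) / n`!%:R
                 * expR (- (c * (n%:R + t)) + a * t))%:E),
         (exists Pi : {measure set R -> \bar R}, is_levy_measure Y Pi)
       & (forall Pi : {measure set R -> \bar R}, is_levy_measure Y Pi ->
            Pi (~` [set x | exists n : nat, (0 < n)%N /\ x = n%:R]) = 0%E /\
            forall n : nat, (0 < n)%N ->
              Pi [set n%:R] =
              (n%:R ^+ n.-1 / n`!%:R * c ^+ n * expR (- (c * n%:R)))%:E)]).
Proof.
move=> PhiY a.
have W0E : lambertW0 (- (c * expR (- c))) = - lambert_root c 0.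
  by rewrite /lambert_root subr0 opprK.
have PhiE z : PhiY z = lambert_root c 0 - lambert_root c z.
  by rewrite /PhiY W0E /lambert_root !opprK addrC.
(* For c <= 1 the root at 0 is c itself, so both cases are the same formula. *)
have aE : a = c - lambert_root c 0.
  rewrite /a W0E; case: ifPn => // c1.
  by apply/esym/eqP; rewrite subr_eq0 -[c == _]eqr_opp -W0E lambertW0_mulexpRN.
split.
  have [nu nu_pos nu_transform] := exists_jump_law hc.
  have [u_gt0 _ _] := lambert_rootP hc (lexx 0).
  have [d [T [P [tau [xi [N [Y [dataY lawxi]]]]]]]] :=
    exists_compound_poisson u_gt0 nu_pos.
  exists d, T, P, Y; split; first by exists (lambert_root c 0), tau, xi, N.
  move=> z z0; rewrite PhiE (compound_poisson_laplace_exponent dataY)//.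
  have -> : jump_transform xi z = lambert_root c z / lambert_root c 0.
    apply: EFin_inj; rewrite -(jump_transformE dataY)// -nu_transform//.
    have mexp := @measurable_expRN R z setT.
    rewrite -(ge0_integral_distribution (xi 0%N) mexp); last first.
      by move=> x; rewrite lee_fin expR_ge0.
    by apply: eq_measure_integral => A mA _; exact: lawxi.
  by field; rewrite gt_eqF.
move=> d T P Y [lambda [tau [xi [N dataY]]]] laplaceY.
split.
- move=> t t0.
  have [|support atoms] := @process_atoms R c hc d T P (Y t) t (ltW t0).
    move=> z z0; rewrite (compound_poisson_transform_exponent dataY)// ?(ltW t0)//.
    by rewrite laplaceY// PhiE.
  by split => // n; rewrite atoms (process_weightE hc n aE t0).
- exact: compound_poisson_levy_measure dataY.
- move=> Pi [Pi_neg levy].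
  have [|support atoms] := levy_measure_atoms hc Pi_neg.
    by move=> z z0; rewrite -levy// laplaceY// PhiE.
  split => // n n0; rewrite atoms//; congr EFin.
  case: n n0 => // n _; rewrite /levy_weight exprMn mulrA; congr (_ * _).
  by rewrite -expRM_natr mulNr.
Qed.
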